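(* Let $a_3,a_4\in\mathbb R$ with $a_3^2+a_4^2\neq0$. Then the Lie group $G(0,0,a_3,a_4)$ is locally isomorphic to $\widetilde{\mathrm{SL}(2,\mathbb R)}\times\widetilde{\mathrm{SL}(2,\mathbb R)}$.
   Context: For $a_1,a_2,a_3,a_4\in\mathbb R$ with $a_1a_4=a_2a_3$, $G(a_1,a_2,a_3,a_4)$ denotes a $6$-dimensional Lie group (it exists by Lie's third theorem) with a basis $e_1,\dots,e_5,A_2$ of its left invariant $1$-forms satisfying $$\begin{aligned} de_1&=A_2\wedge e_2-(2a_1+a_3)e_3\wedge e_5-(2a_2+a_4)e_4\wedge e_5,\\ de_2&=-A_2\wedge e_1+(2a_1+a_3)e_4\wedge e_5-(2a_2+a_4)e_3\wedge e_5,\\ de_3&=-A_2\wedge e_4+(2a_1+a_3)e_1\wedge e_5+(2a_2+a_4)e_2\wedge e_5,\\ de_4&=A_2\wedge e_3-(2a_1+a_3)e_2\wedge e_5+(2a_2+a_4)e_1\wedge e_5,\\ de_5&=-2(a_1-a_3)(e_1\wedge e_3-e_2\wedge e_4)-2(a_2-a_4)(e_1\wedge e_4+e_2\wedge e_3),\\ dA_2&=\alpha\,(e_1\wedge e_2-e_3\wedge e_4), \end{aligned}$$ where $\alpha:=-2\big((a_1-a_3)(2a_1+a_3)+(a_2-a_4)(2a_2+a_4)\big)$. Here $\widetilde{\mathrm{SL}(2,\mathbb R)}$ is the universal cover of $\mathrm{SL}(2,\mathbb R)$. *)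

(* Defs.v *)
From HB Require Import structures.
From mathcomp Require Import all_boot all_order all_algebra.
From mathcomp Require Import all_classical all_reals all_analysis.

Set Implicit Arguments.
Unset Strict Implicit.
Unset Printing Implicit Defensive.

Import Order.TTheory GRing.Theory Num.Theory.
Import numFieldNormedType.Exports.

Local Open Scope classical_set_scope.
Local Open Scope ring_scope.

(* As for [PreTopologicalZmodule], no compatibility between the two structures
   is built in: continuity of the operations is part of [lie_group] below. *)
#[short(type="preTopGroupType")]
HB.structure Definition PreTopGroup := {G of Topological G & Group G}.

HB.saturate prod.

(* All model spaces E, F used below are finite dimensional; there, C^k in the
   usual sense is the same as being differentiable with all directional
   derivatives of class C^(k-1). *)
Fixpoint class_C (R : realType) (E F : normedModType R) (k : nat)
    (W : set E) (f : E -> F) : Prop :=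
  if k is k'.+1 then
    (forall x, W x -> differentiable f x) /\
    (forall v, class_C k' W (fun x => 'D_v f x))
  else forall x, W x -> {for x, continuous f}.

Definition smooth (R : realType) (E F : normedModType R)
    (W : set E) (f : E -> F) : Prop := forall k, class_C k W f.

(* [cmap] and [cinv] are total functions; only their values on [cdom] and
   [crng] matter. *)
Record chart (T : Type) (E : Type) := Chart {
  cdom : set T;
  crng : set E;
  cmap :> T -> E;
  cinv : E -> T }.

Definition is_chart (R : realType) (T : topologicalType) (E : normedModType R)
    (c : chart T E) : Prop :=
  [/\ open (cdom c) /\ open (crng c),
      set_fun (cdom c) (crng c) c /\ set_fun (crng c) (cdom c) (cinv c),
      {in cdom c, cancel c (cinv c)} /\ {in crng c, cancel (cinv c) c} &
      (forall p, cdom c p -> {for p, continuous c}) /\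
      (forall x, crng c x -> {for x, continuous (cinv c)})].

Definition prod_chart (T T' E E' : Type) (c : chart T E) (d : chart T' E') :
    chart (T * T') (E * E') :=
  Chart (cdom c `*` cdom d) (crng c `*` crng d)
    (fun p => (c p.1, d p.2)) (fun x => (cinv c x.1, cinv d x.2)).

Definition prod_atlas (T T' E E' : Type)
    (A : set (chart T E)) (B : set (chart T' E')) :
    set (chart (T * T') (E * E')) :=
  [set prod_chart c d | c in A & d in B].

Definition smooth_map (R : realType) (T T' : topologicalType)
    (E E' : normedModType R) (A : set (chart T E)) (B : set (chart T' E'))
    (W : set T) (f : T -> T') : Prop :=
  (forall p, W p -> {for p, continuous f}) /\
  forall c d, A c -> B d ->
    smooth [set x | [/\ crng c x, W (cinv c x) & cdom d (f (cinv c x))]]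
           (fun x => d (f (cinv c x))).

Definition smooth_atlas (R : realType) (T : topologicalType)
    (E : normedModType R) (A : set (chart T E)) : Prop :=
  [/\ forall c, A c -> is_chart c,
      forall p, exists2 c, A c & cdom c p &
      smooth_map A A setT id].

Definition lie_group (R : realType) (G : preTopGroupType) (E : normedModType R)
    (A : set (chart G E)) : Prop :=
  [/\ hausdorff_space G, @second_countable G, smooth_atlas A,
      smooth_map (prod_atlas A A) A setT (fun p : G * G => (p.1 * p.2)%g) &
      smooth_map A A setT (fun p : G => p^-1%g)].

Definition locally_isomorphic (R : realType) (G H : preTopGroupType)
    (E F : normedModType R) (A : set (chart G E)) (B : set (chart H F)) :
    Prop :=
  exists (U : set G) (V : set H) (f : G -> H) (g : H -> G),
    [/\ open_nbhs 1%g U /\ open_nbhs 1%g V,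
        set_fun U V f /\ set_fun V U g,
        {in U, cancel f g} /\ {in V, cancel g f},
        smooth_map A B U f /\ smooth_map B A V g &
        (forall x y, U x -> U y -> U (x * y)%g -> f (x * y)%g = (f x * f y)%g)
        /\
        (forall x y, V x -> V y -> V (x * y)%g -> g (x * y)%g = (g x * g y)%g)].

Section LeftInvariantForms.
Context (R : realType) (G : preTopGroupType) (E : normedModType R).
Variable A : set (chart G E).

(* [w c x v] is the value of the form w, read in the chart c, at the point
   [cinv c x] on the tangent vector of coordinates v. *)
Definition form1 := chart G E -> E -> E -> R^o.

Definition preserves_form (f : G -> G) (w : form1) : Prop :=
  forall c d x v, A c -> A d -> crng c x -> cdom d (f (cinv c x)) ->
    w d (d (f (cinv c x))) ('D_v (fun y => d (f (cinv c y))) x) = w c x v.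

Definition is_form1 (w : form1) : Prop :=
  [/\ forall c x, A c -> crng c x -> linear (w c x),
      forall c v, A c -> smooth (crng c) (fun x => w c x v) &
      preserves_form id w].

Definition left_invariant (w : form1) : Prop :=
  is_form1 w /\ forall g : G, preserves_form (fun h => (g * h)%g) w.

(* The uniqueness of the coordinates is the linear independence of e. *)
Definition left_invariant_basis (n : nat) (e : n.-tuple form1) : Prop :=
  (forall i, left_invariant (tnth e i)) /\
  forall w, left_invariant w ->
    exists! k : 'rV[R]_n, forall c x v, A c -> crng c x ->
      w c x v = \sum_(i < n) k 0 i * tnth e i c x v.

(* The conventions are d w(X, Y) = X (w Y) - Y (w X) - w [X, Y], applied to
   constant coordinate vector fields, and
   (w /\ w')(u, v) = w u * w' v - w v * w' u. *)
Definition ext_d (w : form1) (c : chart G E) (x u v : E) : R :=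
  'D_u (fun y => w c y v) x - 'D_v (fun y => w c y u) x.

Definition wedge (w w' : form1) (c : chart G E) (x u v : E) : R :=
  w c x u * w' c x v - w c x v * w' c x u.

Definition structure_equations (a1 a2 a3 a4 : R)
    (e1 e2 e3 e4 e5 A2 : form1) : Prop :=
  let alpha :=
    - 2 * ((a1 - a3) * (2 * a1 + a3) + (a2 - a4) * (2 * a2 + a4)) in
  forall c x u v, A c -> crng c x ->
    let d w := ext_d w c x u v in
    let W w w' := wedge w w' c x u v in
    [/\ d e1 = W A2 e2 - (2 * a1 + a3) * W e3 e5 - (2 * a2 + a4) * W e4 e5,
        d e2 = - W A2 e1 + (2 * a1 + a3) * W e4 e5 - (2 * a2 + a4) * W e3 e5,
        d e3 = - W A2 e4 + (2 * a1 + a3) * W e1 e5 + (2 * a2 + a4) * W e2 e5,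
        d e4 = W A2 e3 - (2 * a1 + a3) * W e2 e5 + (2 * a2 + a4) * W e1 e5 &
        d e5 = - 2 * (a1 - a3) * (W e1 e3 - W e2 e4)
               - 2 * (a2 - a4) * (W e1 e4 + W e2 e3) /\
        d A2 = alpha * (W e1 e2 - W e3 e4)].

End LeftInvariantForms.

(* G, with the smooth structure given by the atlas A, is a group
   G(a1, a2, a3, a4). *)
Definition is_G (R : realType) (a1 a2 a3 a4 : R) (G : preTopGroupType)
    (A : set (chart G 'rV[R]_6)) : Prop :=
  lie_group A /\
  exists e1 e2 e3 e4 e5 A2 : form1 G 'rV[R]_6,
    left_invariant_basis A [tuple e1; e2; e3; e4; e5; A2] /\
    structure_equations A a1 a2 a3 a4 e1 e2 e3 e4 e5 A2.

Definition simply_connected (R : realType) (T : topologicalType) : Prop :=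
  let I : set R := [set` `[0, 1]] in
  (forall x y : T, exists gamma : R -> T,
     [/\ {within I, continuous gamma}, gamma 0 = x & gamma 1 = y]) /\
  (forall (x : T) (gamma : R -> T),
     {within I, continuous gamma} -> gamma 0 = x -> gamma 1 = x ->
     exists h : R * R -> T,
       [/\ {within I `*` I, continuous h},
           forall t, I t -> h (t, 0) = gamma t,
           forall t, I t -> h (t, 1) = x &
           forall s, I s -> h (0, s) = x /\ h (1, s) = x]).

(* p is a covering map of the subspace B of Y: each sheet W is mapped
   homeomorphically onto V `&` B, with inverse s. *)
Definition covering_map (X Y : topologicalType) (p : X -> Y) (B : set Y) :
    Prop :=
  [/\ continuous p, range p = B &
      forall y, B y -> exists (V : set Y) (sheets : set (set X)),
        [/\ open_nbhs y V, (forall W, sheets W -> open W),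
            trivIset sheets id, \bigcup_(W in sheets) W = p @^-1` V &
            forall W, sheets W -> exists s : Y -> X,
              [/\ {within V `&` B, continuous s},
                  set_fun (V `&` B) W s,
                  {in V `&` B, cancel s p} & {in W, cancel p s}]]].

Definition SL2 (R : realType) : set 'M[R]_2 := [set M | \det M = 1].

(* S, with the smooth structure given by the atlas A, is the universal covering
   Lie group of SL(2, R). SL(2, R) is an embedded submanifold of the space of
   matrices, so that p is smooth and a local diffeomorphism onto SL(2, R) iff
   it is a smooth immersion as a map into that space. *)
Definition is_universal_cover_SL2 (R : realType) (S : preTopGroupType)
    (A : set (chart S 'rV[R]_3)) : Prop :=
  [/\ lie_group A, simply_connected R S &
      exists p : S -> 'M[R]_2,
        [/\ forall x y, p (x * y)%g = p x *m p y,
            covering_map p (@SL2 R) &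
            forall c, A c ->
              smooth (crng c) (fun x => p (cinv c x)) /\
              forall x v, crng c x -> v != 0 ->
                'D_v (fun y => p (cinv c y)) x != 0]].

(* Main.v *)
Require Import Defs.
From HB Require Import structures.
From mathcomp Require Import all_boot all_order all_algebra.
From mathcomp Require Import all_classical all_reals all_analysis.
From mathcomp Require Import ring lra.
Import numFieldNormedType.Exports.
Set Implicit Arguments.
Unset Strict Implicit.
Unset Printing Implicit Defensive.
Import Order.TTheory GRing.Theory Num.Theory.
Local Open Scope classical_set_scope.
Local Open Scope ring_scope.

(* The structure equations describe sl(2, R) x sl(2, R).  Both Lie groups can be
   compared without integrating vector fields because this algebra has trivial
   center and all its automorphisms near the identity are inner: for g near 1,
   Ad(g) preserves the two factors and acts on each of them as conjugation by a
   2x2 matrix P, given by an explicit polynomial in the entries of Ad(g) and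
   unique up to a scalar.  The projective coordinates of the two matrices P are
   smooth functions of g with injective differential at 1, hence they form a
   chart of G by the inverse function theorem; the projective coordinates of
   the covering map S -> SL(2, R) likewise form a chart of S at 1.  In these
   charts both multiplications are the product of 2x2 matrices up to scalars,
   so equality of coordinates is the local isomorphism. *)

(** * Calculus of class C^k maps *)

(** The obstacle is that an isomorphism of Lie algebras does not by itself give a map of groups, and
    the usual passage needs an exponential map or the Frobenius theorem. Here the structure
    equations are used at the identity only: there the Maurer-Cartan formula turns them into the
    bracket, and away from it all information comes from the multiplicativity of Ad. The matrix P(a)
    of one factor is characterized by Ad(a)(X) P(a) = P(a) X for X in sl(2). This relation is linear
    in P and composes: P(a) P(b) solves the relation for ab. By Schur's lemma an invertible solution
    is unique up to a scalar, so P(ab) is proportional to P(a) P(b). Working with projective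
    coordinates absorbs this scalar, and the same coordinates on SL(2, R) are injective near 1. The
    differential is injective for the same reason: if P has a scalar derivative along v at 1,
    differentiating the relation gives [v, X] = 0 in both factors, so v is central. Ad(a) might
    exchange the two factors; an open condition satisfied at 1 excludes this. *)

Section ClassC.
Context {R : realType}.
Implicit Types E F V : normedModType R.

(** The first-order expansion of [f] at [x] is also one of [g], and uniqueness of the differential
    identifies ['d g x] with ['d f x]. *)
Lemma near_eq_differentiable E F (f g : E -> F) (x : E) :
  {near x, f =1 g} -> differentiable f x -> differentiable g x.
Proof.
move=> fg /[dup] df /diff_locallyP[cd e].
have fx : f x = g x by exact: nbhs_singleton fg.
have e' : g \o shift x = cst (g x) + 'd f x +o_ 0 id.
  apply/eqaddoP => eps eps0.
  have /eqaddoP/(_ _ eps0) := e.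
  have : \forall h \near 0, f (h + x) = g (h + x).
    move: fg; rewrite (near_shift 0 x) /=.
    by apply: filterS => h /=; rewrite subr0.
  apply: filterS2 => h /=.
  by rewrite !fctE /= fx => ->.
have := diff_unique cd e' => dg.
by apply/diff_locallyP; rewrite dg.
Qed.

(** Directional derivatives are total functions on E and continuity is required in all of E, so [W]
    only says at which points the conditions are imposed. This is why restriction to an arbitrary
    subset is harmless. *)
Lemma class_CP E F k (W : set E) (f : E -> F) :
  class_C k W f <-> forall x, W x -> class_C k [set x] f.
Proof.
elim: k f => [|k IH] f /=.
  by split=> [H x Wx _ ->|H x Wx]; [exact: H|exact: (H x Wx x)].
split.
  move=> [df Df] x Wx; split; first by move=> _ ->; exact: df.
  by move=> v; move: (Df v) => /IH/(_ _ Wx).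
move=> H; split; first by move=> x Wx; exact: (H x Wx).1.
by move=> v; apply/IH => x Wx; exact: (H x Wx).2.
Qed.

Lemma class_C_subset E F k (W W' : set E) (f : E -> F) :
  W' `<=` W -> class_C k W f -> class_C k W' f.
Proof.
by move=> WW' /class_CP H; apply/class_CP => x /WW'; exact: H.
Qed.

(** Openness enters because a derivative at a point of [W] depends on the values around that
    point. *)
Lemma eq_class_C E F k (W : set E) (f g : E -> F) :
  open W -> {in W, f =1 g} -> class_C k W f -> class_C k W g.
Proof.
move=> oW; elim: k f g => [|k IH] f g fg /=.
  move=> cf x Wx; suff : g @ x --> f x by rewrite fg ?inE.
  apply: cvg_trans (cf x Wx); apply: near_eq_cvg.
  by apply: filterS (open_nbhs_nbhs (conj oW Wx)) => y Wy; rewrite fg ?inE.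
have nfg x : W x -> {near x, f =1 g}.
  move=> Wx.
  by apply: filterS (open_nbhs_nbhs (conj oW Wx)) => y Wy; rewrite fg ?inE.
move=> [df Df]; split.
  by move=> x Wx; apply: near_eq_differentiable (df x Wx); exact: nfg.
move=> v; apply: IH (Df v) => x; rewrite inE => Wx.
by apply: near_eq_derive; exact: nfg.
Qed.

Lemma class_C_S E F k (W : set E) (f : E -> F) :
  class_C k.+1 W f -> class_C k W f.
Proof.
elim: k f => [|k IH] f [df Df].
  by move=> x Wx; exact/differentiable_continuous/df.
by split=> // v; apply: IH; exact: Df.
Qed.

Lemma class_C_cst E F k (W : set E) (a : F) : class_C k W (fun=> a).
Proof.
elim: k a => [|k IH] a /=; first by move=> x _; exact: cvg_cst.
split; first by move=> x _; exact: differentiable_cst.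
move=> v; have -> : (fun x : E => 'D_v (fun=> a) x) = fun=> 0; last exact: IH.
by apply/funext => x; exact: derive_cst.
Qed.

Lemma derive_comp_linear E V F (f : E -> V) (l : {linear V -> F}) (x v : E) :
  continuous l -> differentiable f x ->
  'D_v (l \o f) x = l ('D_v f x).
Proof.
move=> cl df; rewrite !deriveE //; last first.
  by apply: differentiable_comp => //; exact: linear_differentiable.
rewrite diff_comp //; last exact: linear_differentiable.
by rewrite diff_lin.
Qed.

Lemma class_C_comp_linear E V F k (W : set E) (f : E -> V)
    (l : {linear V -> F}) :
  open W -> continuous l -> class_C k W f -> class_C k W (l \o f).
Proof.
move=> oW cl; elim: k f => [|k IH] f /=.
  by move=> cf x Wx; apply: continuous_comp; [exact: cf|exact: cl].
move=> [df Df]; split.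
  move=> x Wx; apply: differentiable_comp; first exact: df.
  exact: linear_differentiable.
move=> v; apply: eq_class_C (IH _ (Df v)) => // x; rewrite inE => Wx /=.
by rewrite -derive_comp_linear //; exact: df.
Qed.

Lemma class_C_id E k (W : set E) : class_C k W (@id E).
Proof.
case: k => [|k]; first by move=> x _; exact: cvg_id.
split; first by move=> x _.
move=> v; have -> : (fun x : E => 'D_v id x) = fun=> v; last exact: class_C_cst.
by apply/funext=> x; rewrite derive_id.
Qed.

Lemma class_C_linear E F k (W : set E) (l : {linear E -> F}) :
  continuous l -> class_C k W l.
Proof.
move=> cl; apply: (@class_C_subset _ _ _ setT) => //.
exact: (class_C_comp_linear openT cl (class_C_id _ _)).
Qed.

Lemma class_CD E F k (W : set E) (f g : E -> F) : open W ->
  class_C k W f -> class_C k W g -> class_C k W (f \+ g).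
Proof.
move=> oW; elim: k f g => [|k IH] f g /=.
  by move=> cf cg x Wx; apply: cvgD; [exact: cf|exact: cg].
move=> [df Df] [dg Dg]; split.
  by move=> x Wx; apply: differentiableD; [exact: df|exact: dg].
move=> v; apply: eq_class_C (IH _ _ (Df v) (Dg v)) => // x.
rewrite inE => Wx /=; rewrite deriveD //; apply/diff_derivable; [exact: df|exact: dg].
Qed.

Lemma class_C_pair E V F k (W : set E) (f : E -> V) (g : E -> F) : open W ->
  class_C k W f -> class_C k W g -> class_C k W (fun x => (f x, g x)).
Proof.
move=> oW; elim: k f g => [|k IH] f g /=.
  by move=> cf cg x Wx; apply: cvg_pair; [exact: cf|exact: cg].
move=> [df Df] [dg Dg]; split.
  by move=> x Wx; apply: differentiable_pair; [exact: df|exact: dg].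
move=> v; apply: eq_class_C (IH _ _ (Df v) (Dg v)) => // x.
rewrite inE => Wx /=; have ? := df x Wx; have ? := dg x Wx.
rewrite !deriveE // ?diff_pair //; exact: differentiable_pair.
Qed.

(** Scaling is seen as a bilinear map on [R^o * F], so that its differential comes from the general
    rule for bilinear maps. *)
Lemma scale_is_bilinear F :
  bilinear_for
    (GRing.Scale.Law.clone _ _ *:%R _) (GRing.Scale.Law.clone _ _ *:%R _)
    (@GRing.scale R F : R^o -> F -> F).
Proof.
split=> [u'|u] a x y /=.
- by rewrite scalerDl scalerA.
- by rewrite scalerDr !scalerA mulrC.
Qed.
HB.instance Definition _ F := bilinear_isBilinear.Build R R^o F F _ _
  (@GRing.scale R F : R^o -> F -> F) (@scale_is_bilinear F).

Lemma diff_scale E F (a : E -> R^o) (f : E -> F) (x : E) :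
  differentiable a x -> differentiable f x ->
  is_diff x (fun y => a y *: f y) (fun v => a x *: 'd f x v + 'd a x v *: f x).
Proof.
move=> da df.
have cs : continuous (fun p : R^o * F => p.1 *: p.2).
  by move=> p; exact: scale_continuous.
have dp : differentiable (fun y => (a y, f y)) x by exact: differentiable_pair.
pose b := (fun p : R^o * F => p.1 *: p.2).
have -> : (fun y => a y *: f y) = b \o (fun y => (a y, f y)) by [].
have db p : differentiable b p.
  exact: (@differentiable_bilin _ _ _ _ (@GRing.scale R F : R^o -> F -> F) p cs).
split; first exact: differentiable_comp.
rewrite diff_comp // diff_pair // /b.
rewrite (@diff_bilin _ _ _ _ (@GRing.scale R F : R^o -> F -> F) _ cs).
by apply/funext => v.
Qed.

Lemma deriveZfun E F (a : E -> R^o) (f : E -> F) (x v : E) :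
  differentiable a x -> differentiable f x ->
  'D_v (fun y => a y *: f y) x = a x *: 'D_v f x + 'D_v a x *: f x.
Proof.
move=> da df; have [d e] := diff_scale da df.
by rewrite !deriveE // e.
Qed.

Lemma class_CZ E F k (W : set E) (a : E -> R^o) (f : E -> F) : open W ->
  class_C k W a -> class_C k W f -> class_C k W (fun x => a x *: f x).
Proof.
move=> oW; elim: k a f => [|k IH] a f /=.
  by move=> cf cg x Wx; apply: cvgZ; [exact: cf|exact: cg].
move=> /[dup] /class_C_S Ca [df Df] /[dup] /class_C_S Cf [dg Dg]; split.
  by move=> x Wx; have [] := diff_scale (df x Wx) (dg x Wx).
move=> v; apply: (eq_class_C oW _ (class_CD oW (IH _ _ Ca (Dg v)) (IH _ _ (Df v) Cf))).
move=> x; rewrite inE => Wx /=.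
by rewrite deriveZfun //; [exact: df|exact: dg].
Qed.

Lemma class_CM E k (W : set E) (a b : E -> R^o) : open W ->
  class_C k W a -> class_C k W b -> class_C k W (fun x => a x * b x : R^o).
Proof. exact: class_CZ. Qed.

Lemma class_CN E F k (W : set E) (f : E -> F) : open W ->
  class_C k W f -> class_C k W (fun x => - f x).
Proof.
move=> oW Cf; have := class_CZ oW (class_C_cst k W (-1 : R^o)) Cf.
by apply: eq_class_C => // x _; rewrite scaleN1r.
Qed.

Lemma class_CB E F k (W : set E) (f g : E -> F) : open W ->
  class_C k W f -> class_C k W g -> class_C k W (fun x => f x - g x).
Proof. by move=> oW Cf Cg; apply: class_CD => //; exact: class_CN. Qed.

Lemma class_C_sum E F k (W : set E) (I : Type) (r : seq I) (P : pred I)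
    (f : I -> E -> F) : open W ->
  (forall i, P i -> class_C k W (f i)) ->
  class_C k W (fun x => \sum_(i <- r | P i) f i x).
Proof.
move=> oW Cf; have -> : (fun x => \sum_(i <- r | P i) f i x) = \sum_(i <- r | P i) f i.
  by apply/funext => x; rewrite fct_sumE.
elim/big_ind : _ => //; first exact: class_C_cst.
by move=> f1 f2; exact: class_CD.
Qed.

Lemma class_C_prod E k (W : set E) (I : Type) (r : seq I) (P : pred I)
    (f : I -> E -> R^o) : open W ->
  (forall i, P i -> class_C k W (f i)) ->
  class_C k W (fun x => \prod_(i <- r | P i) f i x : R^o).
Proof.
move=> oW Cf; elim: r => [|i r IH].
  by under eq_fun do rewrite big_nil; exact: class_C_cst.
under eq_fun do rewrite big_cons.
by have [Pi|_//] := boolP (P i); apply: class_CM => //; exact: Cf.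
Qed.

Lemma class_CV E k (W : set E) (a : E -> R^o) : open W ->
  (forall x, W x -> a x != 0) -> class_C k W a ->
  class_C k W (fun x => (a x)^-1 : R^o).
Proof.
move=> oW a0; elim: k a a0 => [|k IH] a a0 /=.
  by move=> ca x Wx; apply: cvgV; [exact: a0|exact: ca].
move=> /[dup] /class_C_S Ca [da Da]; split.
  by move=> x Wx; apply: (@differentiableV _ _ a); [exact: da|exact: a0].
move=> v.
have := class_CN oW (class_CM oW (class_CM oW (IH _ a0 Ca) (IH _ a0 Ca)) (Da v)).
apply: eq_class_C => // x; rewrite inE => Wx /=.
rewrite (@deriveV _ _ a) ?a0 //; last by apply: diff_derivable; exact: da.
by rewrite -invfM -expr2 scaleNr.
Qed.

(* A finite resolution of the identity by continuous coordinates. *)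
Definition findim V := exists (I : finType) (b : I -> V) (l : I -> {linear V -> R^o}),
  (forall i, continuous (l i)) /\ forall y, y = \sum_i l i y *: b i.

Lemma derive_coord V F (g : V -> F) (y : V) (I : finType) (b : I -> V)
    (l : I -> R) : differentiable g y ->
  'D_(\sum_i l i *: b i) g y = \sum_i l i *: 'D_(b i) g y.
Proof.
move=> dg; rewrite deriveE // linear_sum; apply: eq_bigr => i _.
by rewrite linearZ /= deriveE.
Qed.

Lemma derive_comp E V F (f : E -> V) (g : V -> F) (x v : E) :
  differentiable f x -> differentiable g (f x) ->
  'D_v (g \o f) x = 'D_('D_v f x) g (f x).
Proof.
move=> df dg; rewrite deriveE; last exact: differentiable_comp.
by rewrite diff_comp // !deriveE.
Qed.

(** In the chain rule [g] is differentiated in the moving direction ['D_v f x], whereas [class_C]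
    speaks of fixed directions. Resolving that direction along the finite family [b] leaves a sum of
    derivatives of [g] in fixed directions, with coefficients to which the induction applies. *)
Lemma class_C_comp E V F k (W : set E) (W' : set V) (f : E -> V) (g : V -> F) :
  findim V -> open W -> set_fun W W' f ->
  class_C k W f -> class_C k W' g -> class_C k W (g \o f).
Proof.
move=> [n [b [l [cl lE]]]] oW fW.
elim: k f fW g => [|k IH] f fW g /=.
  move=> cf cg x Wx; apply: continuous_comp; first exact: cf.
  by apply: cg; exact: fW.
move=> /[dup] /class_C_S Cf [df Df] [dg Dg]; split.
  move=> x Wx; apply: differentiable_comp; first exact: df.
  by apply: dg; exact: fW.
move=> v.
have H i : class_C k W (fun x => l i ('D_v f x) *: 'D_(b i) g (f x)).
  apply: class_CZ => //; first exact: (class_C_comp_linear oW (cl i) (Df v)).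
  exact: (IH f fW _ Cf (Dg (b i))).
have := @class_C_sum _ _ k W _ (index_enum _) predT _ oW (fun i _ => H i).
apply: eq_class_C => // x; rewrite inE => Wx.
rewrite derive_comp; [|exact: df|by apply: dg; exact: fW].
rewrite -(derive_coord _ (fun i => l i ('D_v f x))) -?lE //.
by apply: dg; exact: fW.
Qed.

End ClassC.

(** * Finite dimensional spaces, matrix entries and the mean value theorem on a segment *)

Section Findim.
Context {R : realType}.
Implicit Types E F V : normedModType R.

Definition linear_of E F (f : E -> F) (lf : linear f) : {linear E -> F} :=
  HB.pack f (GRing.isLinear.Build _ _ _ _ _ lf).

Lemma findim_mx m n : @findim R 'M[R]_(m, n).
Proof.
have lin (ij : 'I_m * 'I_n) :
    linear (fun M : 'M[R]_(m, n) => M ij.1 ij.2 : R^o).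
  by move=> a M N; rewrite !mxE.
exists ('I_m * 'I_n)%type, (fun ij => delta_mx ij.1 ij.2),
  (fun ij => linear_of (lin ij)); split.
  by move=> ij; exact: coord_continuous.
by move=> M; rewrite {1}(matrix_sum_delta M) pair_bigA.
Qed.

Lemma findim_prod E F : findim E -> findim F -> findim (E * F)%type.
Proof.
move=> [I [b [l [cl lE]]]] [J [c [h [ch hE]]]].
have linl i : linear (fun p : E * F => l i p.1 : R^o).
  by move=> a p q; rewrite linearP.
have linh i : linear (fun p : E * F => h i p.2 : R^o).
  by move=> a p q; rewrite linearP.
exists (I + J)%type, (fun k => match k with inl i => (b i, 0) | inr j => (0, c j) end),
  (fun k => match k with inl i => linear_of (linl i) | inr j => linear_of (linh j) end); split.
  case=> i p /=.
    by apply: (@continuous_comp _ _ _ fst (l i)); [exact: cvg_fst|exact: cl].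
  by apply: (@continuous_comp _ _ _ snd (h i)); [exact: cvg_snd|exact: ch].
move=> [x y]; rewrite big_sumType /=.
rewrite {1}(lE x) {1}(hE y).
rewrite [RHS]surjective_pairing !raddfD /= !raddf_sum /=.
congr pair.
  by rewrite [X in _ = _ + X]big1 ?addr0 // => i _; rewrite scaler0.
by rewrite [X in _ = X + _]big1 ?add0r // => i _; rewrite scaler0.
Qed.

Lemma findim_linear_continuous V F (l : {linear V -> F}) :
  findim V -> continuous l.
Proof.
move=> [I [b [h [ch hE]]]].
have -> : l = (fun x => \sum_i h i x *: l (b i)) :> (V -> F).
  by apply/funext => x; rewrite {1}(hE x) linear_sum; under eq_bigr do rewrite linearZ.
have := @class_C_sum R V F 0 setT _ (index_enum I) predT
  (fun i x => h i x *: l (b i)) openT.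
move=> H x; apply: H => // i _ y _.
by apply: (@continuous_comp _ _ _ (h i) (fun a : R^o => a *: l (b i))) (ch i y) _;
  exact: scalel_continuous.
Qed.

Lemma class_C_mx E k (W : set E) m n (f : E -> 'M[R]_(m, n)) : open W ->
  (forall i j, class_C k W (fun x => f x i j : R^o)) -> class_C k W f.
Proof.
move=> oW H.
have := @class_C_sum R E 'M[R]_(m, n) k W _ (index_enum ('I_m * 'I_n)%type) predT
  (fun ij x => f x ij.1 ij.2 *: delta_mx ij.1 ij.2) oW.
move=> /(_ _)/wrap[].
  by move=> ij _; apply: class_CZ => //; exact: class_C_cst.
by apply: eq_class_C => // x _ /=; rewrite [RHS]matrix_sum_delta pair_bigA.
Qed.

Lemma class_C_coord E k (W : set E) m n (f : E -> 'M[R]_(m, n)) i j : open W ->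
  class_C k W f -> class_C k W (fun x => f x i j : R^o).
Proof.
move=> oW Cf.
have lin : linear (fun M : 'M[R]_(m, n) => M i j : R^o).
  by move=> a M N; rewrite !mxE.
by apply: (class_C_comp_linear (l := linear_of lin) oW) => //; exact: coord_continuous.
Qed.

Lemma class_C_det E k (W : set E) n (f : E -> 'M[R]_n) : open W ->
  class_C k W f -> class_C k W (fun x => \det (f x) : R^o).
Proof.
move=> oW Cf; apply: class_C_sum => // s _; apply: class_CM => //.
  exact: class_C_cst.
by apply: class_C_prod => // i _; exact: class_C_coord.
Qed.

Lemma class_C_mulmx E k (W : set E) m n p (f : E -> 'M[R]_(m, n))
    (g : E -> 'M[R]_(n, p)) : open W ->
  class_C k W f -> class_C k W g -> class_C k W (fun x => f x *m g x).
Proof.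
move=> oW Cf Cg; apply: class_C_mx => // i j.
under eq_fun do rewrite mxE.
by apply: class_C_sum => // l _; apply: class_CM => //; exact: class_C_coord.
Qed.

Lemma class_C_invmx E k (W : set E) n (f : E -> 'M[R]_n) : open W ->
  (forall x, W x -> f x \in unitmx) ->
  class_C k W f -> class_C k W (fun x => invmx (f x)).
Proof.
move=> oW uf Cf.
(* Cramer's formula: the entries of the inverse are polynomials in the entries of [f x], divided by
   the determinant. *)
have : class_C k W (fun x => (\det (f x))^-1 *: \adj (f x)).
  apply: class_CZ => //.
    apply: class_CV => //; last exact: class_C_det.
    by move=> x Wx; rewrite -unitfE; exact: uf.
  apply: class_C_mx => // i j; under eq_fun do rewrite mxE /cofactor.
  apply: class_CM => //; first exact: class_C_cst.
  apply: class_C_det => //; apply: class_C_mx => // i' j'.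
  by under eq_fun do rewrite !mxE; exact: class_C_coord.
by apply: eq_class_C => // x; rewrite inE => Wx; rewrite /invmx uf.
Qed.

Lemma is_derive_line E F (f : E -> F) (x v : E) (t : R) :
  differentiable f (x + t *: v) ->
  is_derive (t : R^o) 1 (fun s : R^o => f (x + s *: v)) ('D_v f (x + t *: v)).
Proof.
move=> df.
have lin : linear (fun s : R^o => s *: v) by move=> a s r; rewrite scalerDl scalerA.
have cl : continuous (linear_of lin) by move=> s; exact: scalel_continuous.
have d1 : differentiable (linear_of lin) t by exact: linear_differentiable.
have d0 : differentiable (cst x : R^o -> E) t by exact: differentiable_cst.
have dl : differentiable (cst x + linear_of lin : R^o -> E) t.
  exact: differentiableD.
have e : 'D_1 (cst x + linear_of lin : R^o -> E) t = v.
  by rewrite deriveE // diffD // diff_cst diff_lin // /= add0r scale1r.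
apply: DeriveDef.
  apply: diff_derivable.
  by apply: (@differentiable_comp _ _ _ _ (cst x + linear_of lin : R^o -> E) f).
by rewrite (@derive_comp _ _ _ _ (cst x + linear_of lin : R^o -> E) f) ?e.
Qed.

Lemma MVT_line E (f : E -> R^o) (x v : E) (h : R) : 0 < h ->
  (forall t, 0 <= t <= h -> differentiable f (x + t *: v)) ->
  exists2 t, 0 <= t <= h & f (x + h *: v) - f x = h * 'D_v f (x + t *: v).
Proof.
move=> h0 df.
have := @MVT R (fun s : R^o => f (x + s *: v)) (fun t => 'D_v f (x + t *: v)) 0 h h0.
case.
- move=> t; rewrite in_itv /= => /andP[t0 th].
  by apply: is_derive_line; apply: df; rewrite !ltW.
- apply: derivable_within_continuous => t; rewrite in_itv /= => th.
  by have [] := is_derive_line (df t th).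
- move=> t; rewrite in_itv /= => /andP[t0 th] /= e.
  exists t; first by rewrite !ltW.
  by move: e; rewrite scale0r addr0 subr0 mulrC.
Qed.

End Findim.

(** * Mean value estimates and symmetry of second derivatives *)

Section MeanValue.
Context {R : realType}.
Implicit Types E F V : normedModType R.

(** The mean value theorem is applied twice: to the increment [G] of [f] along v, on a segment of
    direction u, and then to ['D_u f] on a segment of direction v. *)
Lemma second_difference E (f : E -> R^o) (x u v : E) (h : R) (W : set E) :
  class_C 2 W f -> 0 < h ->
  (forall s t, 0 <= s <= h -> 0 <= t <= h -> W (x + s *: u + t *: v)) ->
  exists s t, [/\ 0 <= s <= h, 0 <= t <= h &
    f (x + h *: u + h *: v) - f (x + h *: u) - (f (x + h *: v) - f x) =
    h * (h * 'D_v ('D_u f) (x + s *: u + t *: v))].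
Proof.
move=> [df Df] h0 Wh; have h01 : 0 <= h <= h by rewrite ltW /=.
have h00 : 0 <= (0 : R) <= h by rewrite lexx ltW.
pose G (y : E) : R^o := f (y + h *: v) - f y.
have dsh (y : E) : W (y + h *: v) -> differentiable (fun z : E => f (z + h *: v)) y.
  move=> Wy; apply: (@differentiable_comp _ _ _ _ (fun z : E => z + h *: v) f).
    by apply: differentiableD.
  exact: df.
have dG s : 0 <= s <= h -> differentiable G (x + s *: u).
  move=> sh; apply: differentiableB.
    exact/dsh/Wh.
  by apply: df; have := Wh s 0 sh h00; rewrite scale0r addr0.
have [s sh es] := MVT_line h0 dG.
have [df' Df'] := Df u.
have [] := @MVT_line _ E ('D_u f) (x + s *: u) v h h0.
  by move=> t th; apply: df'; exact: Wh.
move=> t th et; exists s, t; split => //.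
rewrite -et; move: es; rewrite /G => e; rewrite addrAC; rewrite addrAC in e; rewrite e.
congr (_ * _); rewrite deriveB.
- congr (_ - _).
  rewrite (@derive_comp _ _ _ _ (fun z : E => z + h *: v) f); last 2 first.
  + by apply: differentiableD.
  + exact/df/Wh.
  congr ('D_ _ _ _).
  by rewrite deriveD // derive_id derive_cst addr0.
- exact/diff_derivable/dsh/Wh.
- by apply/diff_derivable/df; have := Wh s 0 sh h00; rewrite scale0r addr0.
Qed.

Lemma near_parallelogram E (x u v : E) (A : set E) : nbhs x A ->
  exists2 d : R, 0 < d & forall s t, 0 <= s <= d -> 0 <= t <= d ->
    A (x + s *: u + t *: v).
Proof.
move=> /nbhs_normP[e /= e0 eA].
(* The summand 1 keeps the denominator positive when u = v = 0, and the factor 1/2 makes the final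
   inequality strict. *)
pose d := e / (`|u| + `|v| + 1) / 2.
have n0 : 0 < `|u| + `|v| + 1 by rewrite ltr_wpDl // addr_ge0.
have d0 : 0 < d by rewrite !divr_gt0.
exists d => // s t /andP[s0 sd] /andP[t0 td]; apply: eA => /=.
rewrite -addrA opprD addrA subrr sub0r normrN.
apply: (le_lt_trans (ler_normD _ _)); rewrite !normrZ (ger0_norm s0) (ger0_norm t0).
apply: (@le_lt_trans _ _ (d * `|u| + d * `|v|)).
  by apply: lerD; apply: ler_wpM2r.
rewrite -mulrDr; apply: (@lt_le_trans _ _ (d * (`|u| + `|v| + 1) * 2)); last first.
  by have -> : d * (`|u| + `|v| + 1) * 2 = e by rewrite /d; field; rewrite gt_eqF.
have : 0 <= d * (`|u| + `|v|) by rewrite mulr_ge0 ?addr_ge0 // ltW.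
by move: d0; lra.
Qed.

(** The second difference over a parallelogram is symmetric in u and v, so the two mixed derivatives
    agree at some pair of points of any small parallelogram. Their continuity at [x] does the
    rest. *)
Lemma derive_comm_scalar E (W : set E) (f : E -> R^o) (x u v : E) : open W -> W x ->
  class_C 2 W f -> 'D_v ('D_u f) x = 'D_u ('D_v f) x.
Proof.
move=> oW Wx Cf.
have c (a b : E) (e : R) : 0 < e -> \forall y \near x,
    `|'D_b ('D_a f) x - 'D_b ('D_a f) y| < e.
  move=> e0; have [_ /(_ a)[_ /(_ b)/(_ x Wx)]] := Cf.
  by move=> /cvgrPdist_lt/(_ _ e0).
apply/eqP; rewrite -subr_eq0 -normr_eq0; apply/eqP/le_anti/andP; split => //.
apply/ler_addgt0Pl => e e0; rewrite addr0.
have e2 : 0 < e / 2 by rewrite divr_gt0.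
have nW : nbhs x W by exact: open_nbhs_nbhs.
have [d d0 Hd] := near_parallelogram u v (filterI nW (filterI (c u v _ e2) (c v u _ e2))).
have [|s [t [sd td e1]]] := @second_difference E f x u v d W Cf d0.
  by move=> s t sd td; have [] := Hd s t sd td.
have [|s' [t' [sd' td' e1']]] := @second_difference E f x v u d W Cf d0.
  by move=> s' t' sd' td'; have [+ _] := Hd t' s' td' sd'; rewrite addrAC.
(* Both second differences are the same number, and d * d can be cancelled. *)
have cancel2 (a b r k A B : R) : a - b - (r - k) = d * (d * A) ->
    a - r - (b - k) = d * (d * B) -> A = B.
  have dn0 : d != 0 by rewrite gt_eqF.
  move=> eA eB; apply: (mulfI dn0); apply: (mulfI dn0); rewrite -eA -eB; ring.
rewrite (addrAC x (d *: v)) in e1'.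
have E1 := cancel2 _ _ _ _ _ _ e1 e1'.
have [_ [H1 _]] := Hd s t sd td.
have [_ [_]] := Hd t' s' td' sd'; rewrite (addrAC x) => H2.
rewrite distrC in H2; rewrite [e]splitr -(subrKA ('D_v ('D_u f) (x + s *: u + t *: v))).
apply: (le_trans (ler_normD _ _)); rewrite {2}E1.
exact: (lerD (ltW H1) (ltW H2)).
Qed.

Lemma derive_coord_mx E m n (f : E -> 'M[R]_(m, n)) (x v : E) i j :
  differentiable f x -> ('D_v f x) i j = 'D_v (fun y => f y i j : R^o) x.
Proof. by move=> df; rewrite derive_mx ?mxE //; exact: diff_derivable. Qed.

Lemma derive_comm E (W : set E) m n (f : E -> 'M[R]_(m, n)) (x u v : E) :
  open W -> W x -> class_C 2 W f -> 'D_v ('D_u f) x = 'D_u ('D_v f) x.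
Proof.
move=> oW Wx Cf; have [df Df] := Cf; apply/matrixP => i j.
have [dfu _] := Df u; have [dfv _] := Df v.
have nW : nbhs x W by exact: open_nbhs_nbhs.
have H (a b : E) : differentiable ('D_a f) x ->
    ('D_b ('D_a f) x) i j = 'D_b ('D_a (fun y => f y i j : R^o)) x.
  move=> da; transitivity ('D_b (fun y => ('D_a f y) i j : R^o) x).
    exact: derive_coord_mx.
  apply: near_eq_derive; apply: filterS nW => y Wy.
  by apply: derive_coord_mx; exact: df.
transitivity ('D_v ('D_u (fun y => f y i j : R^o)) x); first exact/H/dfu.
transitivity ('D_u ('D_v (fun y => f y i j : R^o)) x); last exact/esym/H/dfv.
by apply: (derive_comm_scalar _ _ oW Wx); exact: class_C_coord.
Qed.

Lemma differentiable_of_bound E F (f : E -> F) x (L : {linear E -> F}) :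
  continuous L ->
  (forall e, 0 < e -> \forall h \near 0, `|f (h + x) - f x - L h| <= e * `|h|) ->
  differentiable f x /\ 'd f x = L :> (E -> F).
Proof.
move=> cL H.
have e' : f \o shift x = cst (f x) + L +o_ 0 id.
  apply/eqaddoP => e e0; apply: filterS (H _ e0) => h /=.
  by rewrite !fctE /= opprD addrA.
have dg := diff_unique cL e'; split => //.
by apply/diff_locallyP; rewrite dg.
Qed.

(** Together with [differentiable_of_bound], this replaces the little-o notation by explicit epsilon
    bounds. *)
Lemma differentiable_bound E F (f : E -> F) x : differentiable f x ->
  forall e, 0 < e -> \forall h \near 0, `|f (h + x) - f x - 'd f x h| <= e * `|h|.
Proof.
move=> /diff_locallyP[_] /eqaddoP H e e0; apply: filterS (H _ e0) => h /=.
by rewrite !fctE /= opprD addrA.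
Qed.

Lemma coord_le_norm m n (M : 'M[R]_(m, n)) i j : `|M i j| <= `|M|.
Proof.
rewrite [leRHS]/Num.Def.normr /= mx_normrE.
by have := le_bigmax 0 (fun ij : 'I_m * 'I_n => `|M ij.1 ij.2|) (i, j); exact.
Qed.

Lemma norm_le_coord m n (M : 'M[R]_(m, n)) a : 0 <= a ->
  (forall i j, `|M i j| <= a) -> `|M| <= a.
Proof.
move=> a0 H; rewrite [leLHS]/Num.Def.normr /= mx_normrE.
by apply: bigmax_le => // -[i j] _; exact: H.
Qed.

Lemma unitmx_of_injective n (A : 'M[R]_n) :
  (forall v : 'rV_n, v *m A = 0 -> v = 0) -> A \in unitmx.
Proof.
move=> H; rewrite -row_free_unit -kermx_eq0; apply/eqP/row_matrixP => i.
by rewrite row0; apply: H; apply/sub_kermxP; exact: row_sub.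
Qed.

End MeanValue.

(** * Inverse function theorem *)

HB.instance Definition _ (R : realType) m n := Complete.on 'M[R]_(m, n).

Section SmallDifferential.
Context {R : realType} (n : nat).
Local Notation E := 'rV[R]_n.

(** Near [x0] the n partial derivatives are small by continuity, which bounds every directional
    derivative. The mean value theorem is scalar, so it is applied to each coordinate; since the
    norm is the maximum of the coordinates, the constant 1/2 is not degraded. *)
Lemma small_differential_lipschitz (r : E -> E) (W : set E) (x0 : E) :
  open W -> W x0 -> class_C 1 W r -> (forall v, 'D_v r x0 = 0) ->
  exists2 d : R, 0 < d & [/\ closed_ball x0 d `<=` W,
    forall z v, closed_ball x0 d z -> `|'D_v r z| <= 2^-1 * `|v| &
    forall x y, closed_ball x0 d x -> closed_ball x0 d y ->
      `|r x - r y| <= 2^-1 * `|x - y|].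
Proof.
move=> oW Wx0 [dr Dr] r0.
(* Dividing by n + 1 instead of n covers the case n = 0. *)
have [eps eps0 ne] : exists2 eps : R, 0 < eps & n%:R * eps <= 2^-1.
  exists (2^-1 / n.+1%:R); first by rewrite divr_gt0 // invr_gt0.
  by rewrite mulrCA ler_piMr ?invr_ge0// ler_pdivrMr // mul1r ler_nat.
have nW : nbhs x0 W by exact: open_nbhs_nbhs.
have nD : \forall z \near x0, forall i : 'I_n, `|'D_(delta_mx 0 i) r z| < eps.
  pose P (i : 'I_n) := [set z | `|'D_(delta_mx 0 i) r z| < eps].
  have nP i : nbhs x0 (P i).
    have /cvgrPdist_lt/(_ _ eps0) := Dr (delta_mx 0 i) x0 Wx0.
    by apply: filterS => z; rewrite r0 sub0r normrN.
  exact: (@filter_forall _ _ P _ (nbhs_filter x0) nP).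
have [e /= e0 eA] := (nbhs_normP _ _).1 (filterI nW nD).
(* Half the radius, so that the closed ball lies in the open ball of radius [e]. *)
have d0 : 0 < e / 2 by rewrite divr_gt0.
have inA z : closed_ball x0 (e / 2) z -> W z /\ forall i, `|'D_(delta_mx 0 i) r z| < eps.
  rewrite closed_ballE //= => zd; apply: eA => /=.
  by apply: (le_lt_trans zd); rewrite ltr_pdivrMr // mulr_natr mulr2n ltrDl.
exists (e / 2) => //.
have bD z v : closed_ball x0 (e / 2) z -> `|'D_v r z| <= 2^-1 * `|v|.
  move=> /inA[Wz Dz].
  rewrite {1}(row_sum_delta v) derive_coord; last exact: dr.
  apply: (le_trans (ler_norm_sum _ _ _)).
  apply: (@le_trans _ _ (\sum_(i < n) `|v| * eps)).
    apply: ler_sum => i _; rewrite normrZ.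
    by apply: ler_pM => //; [exact: coord_le_norm|exact/ltW/Dz].
  rewrite sumr_const card_ord -[leLHS]mulr_natl [leLHS]mulrCA [leRHS]mulrC.
  exact: ler_wpM2l.
split => //; first by move=> z /inA[].
move=> x y xB yB.
apply: norm_le_coord; first by rewrite mulr_ge0 // invr_ge0.
move=> i0 i; rewrite {i0}ord1.
pose f (z : E) : R^o := r z 0 i.
have seg t : 0 <= t <= 1 -> closed_ball x0 (e / 2) (y + t *: (x - y)).
  move: xB yB; rewrite !closed_ballE //= => xB yB /andP[t0 t1].
  rewrite /closed_ball_ /=.
  have -> : x0 - (y + t *: (x - y)) = (1 - t) *: (x0 - y) + t *: (x0 - x).
    by apply/rowP => j; rewrite !mxE; ring.
  apply: (le_trans (ler_normD _ _)); rewrite !normrZ ger0_norm ?subr_ge0 // ger0_norm //.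
  have -> : e / 2 = (1 - t) * (e / 2) + t * (e / 2) by ring.
  by apply: lerD; apply: ler_wpM2l => //; rewrite subr_ge0.
have [|t /seg tB] := @MVT_line _ _ f y (x - y) 1 ltr01.
  move=> t /seg /inA[Wz _].
  have [dC _] : class_C 1 W f by apply: class_C_coord => //; split.
  exact: dC.
rewrite scale1r subrKC mul1r /f => e1.
rewrite !mxE; change (`|f x - f y| <= 2^-1 * `|x - y|).
rewrite /f e1 -derive_coord_mx; last by apply: dr; have [] := inA _ tB.
exact: le_trans (coord_le_norm _ _ _) (bD _ _ tB).
Qed.

Lemma fixed_point_ball (f : E -> E) (x0 : E) (d : R) : 0 < d ->
  (forall x, closed_ball x0 d x -> closed_ball x0 d (f x)) ->
  (forall x y, closed_ball x0 d x -> closed_ball x0 d y ->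
    `|f x - f y| <= 2^-1 * `|x - y|) ->
  exists2 p, closed_ball x0 d p & f p = p.
Proof.
move=> d0 fB fl.
pose F : {fun closed_ball x0 d >-> closed_ball x0 d} := [fun of mkfun fB].
have h0 : 0 <= (2^-1 : R) by rewrite invr_ge0.
have [|||p pB e] := @banach_fixed_point R _ _ F.
- exists (NngNum h0); split => /=; first by rewrite invf_lt1 // ltr1n.
  by move=> [x y] /= [xB yB]; exact: fl.
- exact: closed_ball_closed.
- by exists x0; exact: closed_ballxx.
- by exists p.
Qed.

(** As [L] inverts the differential of [f], the error of [L] as an expansion of [g] is, up to sign,
    the image under [L] of the expansion error of [f] at [g y]. The latter is small compared with
    the increment of [g], which the Lipschitz bound compares with the increment of y. *)
Lemma inverse_differentiable (E1 E2 : normedModType R) (f : E1 -> E2)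
    (g : E2 -> E1) (V : set E2) (c : R) (y : E2) (L : {linear E2 -> E1}) :
  open V -> {in V, cancel g f} ->
  (forall y z, V y -> V z -> `|g y - g z| <= c * `|y - z|) -> 0 < c ->
  V y -> differentiable f (g y) -> continuous L ->
  (forall v, L ('d f (g y) v) = v) ->
  differentiable g y /\ 'd g y = L :> (E2 -> E1).
Proof.
move=> oV gK gl c0 Vy df cL LK.
have [C C0 LC] := linear_lipschitz cL.
have nV : nbhs y V by exact: open_nbhs_nbhs.
have cg : {for y, continuous g}.
  apply/cvgrPdist_le => e e0.
  have ne : \forall z \near y, `|y - z| <= e / c.
    have /cvgrPdist_le/(_ (e / c)) : z @[z --> y] --> y by exact: cvg_id.
    by rewrite divr_gt0 // => /(_ isT).
  apply: filterS2 nV ne => z Vz he.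
  apply: (le_trans (gl _ _ Vy Vz)).
  by rewrite mulrC -ler_pdivlMr.
apply: differentiable_of_bound => // e e0.
have e'0 : 0 < e / (C * c) by rewrite divr_gt0 // mulr_gt0.
have nb := differentiable_bound df e'0.
have nb' : \forall z \near y, `|f ((g z - g y) + g y) - f (g y) -
    'd f (g y) (g z - g y)| <= e / (C * c) * `|g z - g y|.
  have c1 : g z - g y @[z --> y] --> (0 : E1).
    by rewrite -(subrr (g y)); apply: cvgB => //; exact: cvg_cst.
  exact: c1 _ nb.
have : \forall z \near y, V z /\ `|f ((g z - g y) + g y) - f (g y) -
    'd f (g y) (g z - g y)| <= e / (C * c) * `|g z - g y| by exact: filterI.
rewrite (near_shift 0 y) /=; apply: filterS => h /=; rewrite subr0 => -[Vh].
rewrite subrK !gK ?inE // addrK => H.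
have eL : g (h + y) - g y - L h = - L (h - 'd f (g y) (g (h + y) - g y)).
  by rewrite linearB opprB LK.
rewrite eL normrN; apply: (le_trans (LC _)).
rewrite mulrC -ler_pdivlMr //; apply: (le_trans H).
apply: (@le_trans _ _ (e / (C * c) * (c * `|h|))).
  apply: ler_wpM2l; first exact: ltW.
  by have := gl _ _ Vh Vy; rewrite addrK.
suff -> : e / (C * c) * (c * `|h|) = e * `|h| / C by [].
by field; rewrite !gt_eqF.
Qed.

(** Bootstrapping: the derivative of [g] is a smooth function of [g] itself, so if [g] is of class
    C^k then so is its derivative, and [g] is of class C^(k+1). *)
Lemma class_C_inverse (f g : E -> E) (U V : set E) k :
  open U -> open V -> set_fun V U g -> smooth U f ->
  (forall x, U x -> 'J f x \in unitmx) ->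
  (forall y, V y -> differentiable g y /\
    forall v, 'D_v g y = v *m invmx ('J f (g y))) ->
  class_C k V g.
Proof.
move=> oU oV gV sf uf dg; elim: k => [|k IH].
  by move=> y /dg[d _]; exact: differentiable_continuous.
split; first by move=> y /dg[].
move=> v.
have : class_C k V ((fun x => v *m invmx ('J f x)) \o g).
  apply: (class_C_comp _ oV gV IH); first exact: findim_mx.
  apply: class_C_mulmx => //; first exact: class_C_cst.
  apply: class_C_invmx => //; apply: class_C_mx => // i j.
  have [dfU /(_ (delta_mx 0 i)) Df] := sf k.+1.
  have := class_C_coord 0 j oU Df; apply: eq_class_C => // x; rewrite inE => Ux.
  by rewrite mxE deriveE //; exact: dfU.
by apply: eq_class_C => // y; rewrite inE => /dg[_ e] /=; rewrite e.
Qed.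

End SmallDifferential.

Section InverseFunctionTheorem.
Context {R : realType} (n : nat).
Local Notation E := 'rV[R]_n.

Lemma inverse_function_near_id (f : E -> E) (W : set E) (x0 : E) :
  open W -> W x0 -> smooth W f -> (forall v, 'D_v f x0 = v) ->
  exists U V g, [/\ open U /\ open V, U x0 /\ U `<=` W,
    set_fun U V f /\ set_fun V U g, {in U, cancel f g} /\ {in V, cancel g f} &
    smooth V g].
Proof.
move=> oW Wx0 sf f0.
have [df _] := sf 1.
pose r (x : E) : E := x - f x.
have Dr z v : W z -> 'D_v r z = v - 'D_v f z.
  move=> Wz; rewrite /r deriveB ?derive_id //.
  by apply: diff_derivable; exact: df.
have [|v|d d0 [dW bD br]] := @small_differential_lipschitz R n r W x0 oW Wx0.
- by apply: class_CB => //; exact: class_C_id.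
- by rewrite Dr // f0 subrr.
(* This estimate gives the injectivity of [f] on the ball and the Lipschitz constant 2 of its
   inverse. *)
have expand x y : closed_ball x0 d x -> closed_ball x0 d y ->
    `|x - y| <= 2 * `|f x - f y|.
  move=> Bx By; have := br _ _ Bx By.
  have -> : x - y = (r x - r y) + (f x - f y).
    by rewrite /r opprD opprK !addrA; apply/rowP => j; rewrite !mxE; ring.
  have := ler_normD (r x - r y) (f x - f y).
  set a := `|_ + _|; set b := `|r x - r y|; set c := `|f x - f y|; lra.
(* A solution of f x = y is a fixed point of x |-> r x + y. This map moves the center by less than
   d/2 + d/2 when y is in [V]: one half from the contraction, the other from the distance of y to
   [f x0]. *)
pose V : set E := ball (f x0) (d / 2).
have B x : ball x0 d x -> closed_ball x0 d x.
  by rewrite -ball_normE closed_ballE //= => /ltW.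
pose U : set E := ball x0 d `&` (f @^-1` V).
have Bx0 : closed_ball x0 d x0 by exact: closed_ballxx.
have sol y : V y -> exists x, ball x0 d x /\ f x = y.
  rewrite /V -ball_normE /= => Vy.
  have inB x : closed_ball x0 d x -> `|x0 - (r x + y)| < d.
    move=> Bx; have := br _ _ Bx0 Bx.
    move: (Bx); rewrite closed_ballE //= => Bx'.
    have -> : x0 - (r x + y) = (r x0 - r x) + (f x0 - y).
      by rewrite /r; apply/rowP => j; rewrite !mxE; ring.
    have := ler_normD (r x0 - r x) (f x0 - y).
    move: Bx'; rewrite /closed_ball_ /=; move: Vy.
    set a := `|_ + _|; set b := `|r x0 - r x|; set c := `|f x0 - y|; lra.
  have [x Bx|x z Bx Bz|p Bp e] := @fixed_point_ball R n (fun x => r x + y) x0 d d0.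
  - by rewrite closed_ballE //=; apply: ltW; exact: inB.
  - by rewrite opprD addrACA subrr addr0; exact: br.
  exists p; split; first by have := inB p Bp; rewrite e.
  by apply/rowP => j; move/rowP: e => /(_ j); rewrite /r !mxE; lra.
(* Outside [V] the center [x0] serves as a default value, since [g] is a total function. *)
have /choice[g gP] : forall y, exists x, V y -> ball x0 d x /\ f x = y.
  move=> y; have [Vy|nVy] := pselect (V y); last by exists x0.
  by have [x xP] := sol y Vy; exists x.
have oV : open V by exact: ball_open.
have BW x : ball x0 d x -> W x by move=> /B/dW.
have cf x : ball x0 d x -> {for x, continuous f}.
  by move=> /BW Wx; exact/differentiable_continuous/df.
have oU : open U.
  rewrite openE => x [Bx Vx]; apply: filterI.
    by apply: open_nbhs_nbhs; split => //; exact: ball_open.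
  by apply: (cf x Bx); exact: open_nbhs_nbhs.
have gV : set_fun V U g.
  by move=> y Vy; have [Bg e] := gP y Vy; split => //; rewrite /preimage /= e.
have gK : {in V, cancel g f} by move=> y; rewrite inE => /gP[].
(* On the kernel of the differential of [f], the differential of [r] is the identity; being bounded
   by 1/2, it forces the vector to be 0. *)
have uf x : U x -> 'J f x \in unitmx.
  move=> [Bx _]; apply: unitmx_of_injective => v e.
  have /(_ v) := bD x ^~ (B x Bx).
  rewrite Dr ?deriveEjacobian ?e; [|exact/df/BW|exact: BW].
  rewrite subr0 => vle; apply/eqP; rewrite -normr_le0.
  by move: vle; set a := `|v|; lra.
have gl y z : V y -> V z -> `|g y - g z| <= 2 * `|y - z|.
  move=> Vy Vz; have [By ey] := gP y Vy; have [Bz ez] := gP z Vz.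
  by have := expand _ _ (B _ By) (B _ Bz); rewrite ey ez.
have dg y : V y -> differentiable g y /\
    forall v, 'D_v g y = v *m invmx ('J f (g y)).
  move=> Vy; pose L := mulmxr (invmx ('J f (g y))) : {linear E -> E}.
  have cL : continuous L by exact: findim_linear_continuous (findim_mx _ _).
  have dfy : differentiable f (g y) by exact/df/BW/(gV y Vy).1.
  have [|d1 d2] := inverse_differentiable oV gK gl (ltr0n R 2) Vy dfy cL.
    move=> v; rewrite /L /= -deriveE // deriveEjacobian // mulmxK //.
    exact/uf/gV.
  by split => // v; rewrite deriveE // d2.
exists U, V, g; split => //.
- split; last by move=> x [/BW].
  split; first exact: ballxx.
  by rewrite /V /preimage /=; apply: ballxx; rewrite divr_gt0.
- by split => // x [].
- split => // x; rewrite inE => -[Bx Vx].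
  have [Bg e] := gP _ Vx; apply/subr0_eq/eqP; rewrite -normr_le0.
  by have := expand _ _ (B _ Bg) (B _ Bx); rewrite e subrr normr0 mulr0.
- move=> k; apply: (class_C_inverse k oU oV gV _ uf dg).
  by move=> j; apply: class_C_subset (sf j) => x [/BW].
Qed.

(** Composing [f] with the inverse of its differential at [x0] reduces to a map whose differential
    there is the identity. *)
Lemma inverse_function (f : E -> E) (W : set E) (x0 : E) :
  open W -> W x0 -> smooth W f -> (forall v, 'D_v f x0 = 0 -> v = 0) ->
  exists U V g, [/\ open U /\ open V, U x0 /\ U `<=` W,
    set_fun U V f /\ set_fun V U g, {in U, cancel f g} /\ {in V, cancel g f} &
    smooth V g].
Proof.
move=> oW Wx0 sf f0.
have df : differentiable f x0 by have [+ _] := sf 1; exact.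
have uA : 'J f x0 \in unitmx.
  by apply: unitmx_of_injective => v; rewrite -deriveEjacobian //; exact: f0.
set A := 'J f x0 in uA.
pose l := mulmxr (invmx A) : {linear E -> E}.
pose h := mulmxr A : {linear E -> E}.
have cl : continuous l by exact: findim_linear_continuous (findim_mx _ _).
have ch : continuous h by exact: findim_linear_continuous (findim_mx _ _).
have [||U [V [g [[oU oV] [Ux0 UW] [fU gV] [fK gK] sg]]]] :=
    @inverse_function_near_id (l \o f) W x0 oW Wx0.
- by move=> k; exact: class_C_comp_linear.
- by move=> v; rewrite derive_comp_linear // deriveEjacobian //= mulmxK.
exists U, (l @^-1` V), (g \o l); split.
- by split => //; apply: open_comp => // ? _; exact: cl.
- by [].
- by split => // y /gV.
- split; first by move=> x Ux /=; exact: fK.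
  move=> y; rewrite inE /preimage /= => Vy.
  have : l (f (g (l y))) = l y by rewrite -[LHS]/((l \o f) (g (l y))) gK ?inE.
  by move=> /(congr1 h) /=; rewrite !mulmxKV.
- move=> k; apply: (@class_C_comp _ _ _ _ k _ V) => //.
  + exact: findim_mx.
  + by apply: open_comp => // ? _; exact: cl.
  + exact: class_C_linear.
Qed.
End InverseFunctionTheorem.

(** * Matrix-valued functions *)

Section MatrixCalculus.
Context {R : realType}.
Implicit Types E F V : normedModType R.

Lemma open_preimage_in (T U : topologicalType) (W : set T) (f : T -> U)
    (D : set U) : open W -> (forall x, W x -> {for x, continuous f}) ->
  open D -> open (W `&` f @^-1` D).
Proof.
move=> oW cf oD; rewrite openE => x [Wx Dx]; apply: filterI.
  exact: open_nbhs_nbhs.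
by apply: (cf x Wx); exact: open_nbhs_nbhs.
Qed.

Lemma derive_mulmx E m n p (f : E -> 'M[R]_(m, n)) (g : E -> 'M[R]_(n, p)) x v :
  differentiable f x -> differentiable g x ->
  'D_v (fun y => f y *m g y) x = 'D_v f x *m g x + f x *m 'D_v g x.
Proof.
move=> df dg.
have dc m' n' (h : E -> 'M[R]_(m', n')) i j : differentiable h x ->
    derivable (fun y => h y i j : R^o) x v.
  by move=> dh; move: i j; apply/derivable_mxP; exact: diff_derivable.
have dm i j : is_derive x v (fun y => (f y *m g y) i j : R^o)
    ((('D_v f x) *m g x + f x *m 'D_v g x) i j).
  have -> : (fun y => (f y *m g y) i j : R^o) =
      \sum_(k < n) ((fun y => f y i k : R^o) * (fun y => g y k j)).
    by apply/funext => y; rewrite mxE fct_sumE.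
  have H k : is_derive x v ((fun y => f y i k : R^o) * (fun y => g y k j))
      (f x i k *: ('D_v g x) k j + g x k j *: ('D_v f x) i k).
    have := dc _ _ f i k df => /derivableP; rewrite -derive_coord_mx // => d1.
    have := dc _ _ g k j dg => /derivableP; rewrite -derive_coord_mx // => d2.
    exact: is_deriveM.
  apply: is_derive_eq; rewrite !mxE -big_split /=; apply: eq_bigr => k _.
  by rewrite /GRing.scale /=; ring.
have dm' : derivable (fun y => f y *m g y) x v.
  by apply/derivable_mxP => i j; have [d _] := dm i j; exact: d.
by rewrite derive_mx //; apply/matrixP => i j; rewrite mxE; have [_ d] := dm i j; exact: d.
Qed.

Lemma derive_mulmxl E m n p (B : 'M[R]_(m, n)) (g : E -> 'M[R]_(n, p)) x v :
  differentiable g x -> 'D_v (fun y => B *m g y) x = B *m 'D_v g x.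
Proof.
move=> dg; have dB := @differentiable_cst R E 'M[R]_(m, n) B x.
by have := derive_mulmx v dB dg; rewrite derive_cst mul0mx add0r.
Qed.

Lemma derive_mulmxr E m n p (f : E -> 'M[R]_(m, n)) (B : 'M[R]_(n, p)) x v :
  differentiable f x -> 'D_v (fun y => f y *m B) x = 'D_v f x *m B.
Proof.
move=> df; have dB := @differentiable_cst R E 'M[R]_(n, p) B x.
by have := derive_mulmx v df dB; rewrite derive_cst mulmx0 addr0.
Qed.

Lemma class_C_jacobian E k n m (W : set E) (f : E -> 'rV[R]_n -> 'rV[R]_m)
    (y : E -> 'rV[R]_n) :
  open W -> (forall x, W x -> differentiable (f x) (y x)) ->
  (forall v, class_C k W (fun x => 'D_v (f x) (y x))) ->
  class_C k W (fun x => 'J (f x) (y x)).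
Proof.
move=> oW df Cf; apply: class_C_mx => // i j.
have := class_C_coord 0 j oW (Cf (delta_mx 0 i)).
by apply: eq_class_C => // x; rewrite inE => Wx; rewrite mxE deriveE //; exact: df.
Qed.

Lemma mulmx_inj n m (A B : 'M[R]_(n, m)) :
  (forall v : 'rV_n, v *m A = v *m B) -> A = B.
Proof. by move=> H; apply/row_matrixP => i; rewrite !rowE. Qed.

(** Jacobians act on row vectors from the right, so the map applied first stands on the left. All
    products below inherit this order. *)
Lemma jacobian_comp n m p (f : 'rV[R]_n -> 'rV[R]_m) (g : 'rV[R]_m -> 'rV[R]_p) x :
  differentiable f x -> differentiable g (f x) ->
  'J (g \o f) x = 'J f x *m 'J g (f x).
Proof.
move=> df dg; apply: mulmx_inj => v.
have dgf : differentiable (g \o f) x by exact: differentiable_comp.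
rewrite mulmxA -(deriveEjacobian v df) -(deriveEjacobian _ dg).
by rewrite -(deriveEjacobian v dgf) derive_comp.
Qed.

Lemma near_eq_jacobian n m (f g : 'rV[R]_n -> 'rV[R]_m) x : {near x, f =1 g} ->
  differentiable f x -> 'J f x = 'J g x.
Proof.
move=> fg df; apply: mulmx_inj => v.
have dg : differentiable g x by exact: near_eq_differentiable df.
transitivity ('D_v f x); first exact: esym (deriveEjacobian v df).
transitivity ('D_v g x); last exact: deriveEjacobian v dg.
exact: near_eq_derive.
Qed.

Lemma jacobian_id n (x : 'rV[R]_n) : 'J id x = 1%:M.
Proof.
by apply: mulmx_inj => v; rewrite -deriveEjacobian // derive_id mulmx1.
Qed.

Lemma differentiable_pairl E F (x : E) (y : F) : differentiable (fun z => (z, y)) x.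
Proof. by apply: differentiable_pair => //; exact: differentiable_cst. Qed.

Lemma differentiable_pairr E F (x : E) (y : F) : differentiable (fun z => (x, z)) y.
Proof. by apply: differentiable_pair => //; exact: differentiable_cst. Qed.

Lemma derive_pairl E F V (f : E * F -> V) (x : E) (y : F) v :
  differentiable f (x, y) ->
  'D_v (fun z => f (z, y)) x = 'D_(v, 0) f (x, y).
Proof.
move=> df; have dp := differentiable_pairl x y.
have e : 'D_v (fun z => (z, y)) x = (v, 0).
  by rewrite (deriveE _ dp) diff_pair // diff_cst -deriveE // derive_id.
by have := derive_comp v dp df; rewrite e.
Qed.

Lemma derive_pairr E F V (f : E * F -> V) (x : E) (y : F) v :
  differentiable f (x, y) ->
  'D_v (fun z => f (x, z)) y = 'D_(0, v) f (x, y).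
Proof.
move=> df; have dp := differentiable_pairr x y.
have e : 'D_v (fun z => (x, z)) y = (0, v).
  by rewrite (deriveE _ dp) diff_pair // diff_cst -deriveE // derive_id.
by have := derive_comp v dp df; rewrite e.
Qed.

End MatrixCalculus.

(** * Lie groups in a chart *)

Lemma class_C_fst (R : realType) (E F : normedModType R) k (W : set (E * F)) :
  class_C k W (fst : E * F -> E).
Proof.
have lf : linear (fst : E * F -> E) by [].
by apply: (@class_C_linear _ _ _ k W (linear_of lf)) => x; exact: cvg_fst.
Qed.

Lemma class_C_snd (R : realType) (E F : normedModType R) k (W : set (E * F)) :
  class_C k W (snd : E * F -> F).
Proof.
have ls : linear (snd : E * F -> F) by [].
by apply: (@class_C_linear _ _ _ k W (linear_of ls)) => x; exact: cvg_snd.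
Qed.

Lemma open_prod (T U : topologicalType) (A : set T) (B : set U) :
  open A -> open B -> open (A `*` B).
Proof.
move=> oA oB; rewrite openE => -[x y] [/= Ax By].
by exists (A, B) => //; split => /=; exact: open_nbhs_nbhs.
Qed.

Section LieGroup.
Context {R : realType} {E : normedModType R} {G : preTopGroupType}.
Variable A : set (chart G E).
Hypothesis LG : lie_group A.

Lemma lie_mul_continuous (p : G * G) :
  {for p, continuous (fun p : G * G => (p.1 * p.2)%g)}.
Proof. by have [_ _ _ [cm _] _] := LG; exact: cm. Qed.

Lemma lie_inv_continuous (a : G) : {for a, continuous (fun a : G => a^-1%g)}.
Proof. by have [_ _ _ _ [ci _]] := LG; exact: ci. Qed.

Lemma lie_mul_for (T : topologicalType) (f g : T -> G) (x : T) :
  {for x, continuous f} -> {for x, continuous g} ->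
  {for x, continuous (fun x => (f x * g x)%g)}.
Proof.
move=> cf cg.
apply: (@continuous_comp _ _ _ (fun x => (f x, g x)) (fun p : G * G => (p.1 * p.2)%g)).
  exact: cvg_pair.
exact: lie_mul_continuous.
Qed.

Lemma lie_inv_for (T : topologicalType) (f : T -> G) (x : T) :
  {for x, continuous f} -> {for x, continuous (fun x => (f x)^-1%g)}.
Proof.
move=> cf; apply: (@continuous_comp _ _ _ f (fun a : G => a^-1%g)) => //.
exact: lie_inv_continuous.
Qed.

Variable c : chart G E.
Hypotheses (fE : findim E) (Ac : A c) (c1 : cdom c 1%g).
Local Notation ci := (cinv c).
Local Notation x0 := (c 1%g).

Lemma lie_is_chart : is_chart c.
Proof. by have [_ _ [H _ _] _ _] := LG; exact: H. Qed.

Lemma open_cdom : open (cdom c). Proof. by have [[]] := lie_is_chart. Qed.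
Lemma open_crng : open (crng c). Proof. by have [[]] := lie_is_chart. Qed.

Lemma crng_chart a : cdom c a -> crng c (c a).
Proof. by have [_ [H _] _ _] := lie_is_chart; exact: H. Qed.

Lemma cdom_cinv x : crng c x -> cdom c (ci x).
Proof. by have [_ [_ H] _ _] := lie_is_chart; exact: H. Qed.

Lemma chartK a : cdom c a -> ci (c a) = a.
Proof. by have [_ _ [H _] _] := lie_is_chart => ca; apply: H; rewrite inE. Qed.

Lemma cinvK x : crng c x -> c (ci x) = x.
Proof. by have [_ _ [_ H] _] := lie_is_chart => ca; apply: H; rewrite inE. Qed.

Lemma cinv_continuous x : crng c x -> {for x, continuous ci}.
Proof. by have [_ _ _ [_ H]] := lie_is_chart; exact: H. Qed.

Lemma cinv_chart1 : ci x0 = 1%g. Proof. exact: chartK. Qed.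
Lemma crng_chart1 : crng c x0. Proof. exact: crng_chart. Qed.

(** The chart is not centered: the unit of the group has coordinates [c 1], which need not be 0. *)
Definition chart_mul (p : E * E) : E := c (ci p.1 * ci p.2)%g.
Definition mul_dom : set (E * E) :=
  [set p | [/\ crng c p.1, crng c p.2 & cdom c (ci p.1 * ci p.2)%g]].

Lemma cinv_fst_continuous (p : E * E) : crng c p.1 ->
  {for p, continuous (fun p : E * E => ci p.1)}.
Proof.
move=> Wp; apply: (@continuous_comp _ _ _ fst ci); first exact: cvg_fst.
exact: cinv_continuous.
Qed.

Lemma cinv_snd_continuous (p : E * E) : crng c p.2 ->
  {for p, continuous (fun p : E * E => ci p.2)}.
Proof.
move=> Wp; apply: (@continuous_comp _ _ _ snd ci); first exact: cvg_snd.
exact: cinv_continuous.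
Qed.

Lemma open_mul_dom : open mul_dom.
Proof.
have -> : mul_dom = (crng c `*` crng c) `&`
    (fun p : E * E => (ci p.1 * ci p.2)%g) @^-1` cdom c.
  by apply/seteqP; split => p /=; [move=> [? ? ?]|move=> [[? ?] ?]].
apply: open_preimage_in; last exact: open_cdom.
  by apply: open_prod; exact: open_crng.
move=> p [p1 p2]; apply: lie_mul_for.
  exact: cinv_fst_continuous.
exact: cinv_snd_continuous.
Qed.

Lemma smooth_chart_mul : smooth mul_dom chart_mul.
Proof.
have [_ _ _ [_ H] _] := LG => k.
have AAc : prod_atlas A A (prod_chart c c) by exists c => //; exists c.
by apply: class_C_subset (H _ _ AAc Ac k) => p [].
Qed.

Definition inv_dom : set E := [set x | crng c x /\ cdom c (ci x)^-1%g].

Lemma open_inv_dom : open inv_dom.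
Proof.
apply: open_preimage_in; [exact: open_crng| |exact: open_cdom].
by move=> x Wx; apply: lie_inv_for; exact: cinv_continuous.
Qed.

Lemma smooth_chart_inv : smooth inv_dom (fun x => c (ci x)^-1%g).
Proof.
have [_ _ _ _ [_ H]] := LG => k.
by apply: class_C_subset (H _ _ Ac Ac k) => x [].
Qed.

Definition chart_conj (p : E * E) : E := c (ci p.1 * ci p.2 * (ci p.1)^-1)%g.
(** The conditions keep the product x y, the inverse of x and the final product all in the chart, so
    that conjugation factors through [chart_mul] and the inversion in coordinates. *)
Definition conj_dom : set (E * E) :=
  [set p | [/\ mul_dom p, inv_dom p.1 & cdom c (ci p.1 * ci p.2 * (ci p.1)^-1)%g]].

Lemma open_conj_dom : open conj_dom.
Proof.
have -> : conj_dom = (mul_dom `&` (inv_dom `*` setT)) `&`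
    (fun p : E * E => (ci p.1 * ci p.2 * (ci p.1)^-1)%g) @^-1` cdom c.
  by apply/seteqP; split => p /=; [move=> [? ? ?]|move=> [[? [? _]] ?]].
apply: open_preimage_in; last exact: open_cdom.
  apply: openI; first exact: open_mul_dom.
  by apply: open_prod; [exact: open_inv_dom|exact: openT].
move=> p [[p1 p2 _] _]; apply: lie_mul_for; first apply: lie_mul_for.
- exact: cinv_fst_continuous.
- exact: cinv_snd_continuous.
- by apply: lie_inv_for; exact: cinv_fst_continuous.
Qed.

Lemma smooth_chart_conj : smooth conj_dom chart_conj.
Proof.
move=> k.
have fEE : findim (E * E)%type by exact: findim_prod.
have oC := open_conj_dom.
have Ci : class_C k conj_dom (fun p : E * E => c (ci p.1)^-1%g).
  apply: (@class_C_comp _ _ _ _ k _ inv_dom fst (fun x => c (ci x)^-1%g)) => //.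
  - by move=> p [].
  - exact: class_C_fst.
  - exact: smooth_chart_inv.
have Cm : class_C k conj_dom (fun p => (chart_mul p, c (ci p.1)^-1%g)).
  apply: class_C_pair => //.
  by apply: class_C_subset (smooth_chart_mul k) => p [].
have := @class_C_comp _ _ _ _ k _ mul_dom _ chart_mul fEE oC _ Cm (smooth_chart_mul k).
have P p : conj_dom p -> [/\ mul_dom p, cdom c (ci p.1)^-1%g &
    cdom c (ci p.1 * ci p.2 * (ci p.1)^-1)%g].
  by move=> [? [? ?] ?].
have -> : set_fun conj_dom mul_dom (fun p => (chart_mul p, c (ci p.1)^-1%g)) = True.
  apply/propext; split => // _ p /P[[p1 p2 p12] p3 p4].
  split => /=; [exact: crng_chart|exact: crng_chart|].
  by rewrite /chart_mul !chartK.
move=> /(_ I); apply: eq_class_C => // p; rewrite inE => /P[[p1 p2 p12] p3 p4].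
by rewrite /= /chart_mul /chart_conj /= !chartK.
Qed.

Definition sym_dom : set G := [set a | cdom c a /\ cdom c a^-1%g].

Lemma sym_dom_cinv x : inv_dom x -> sym_dom (ci x).
Proof. by move=> [? ?]; split => //; exact: cdom_cinv. Qed.

Lemma inv_dom_chart a : sym_dom a -> inv_dom (c a).
Proof. by move=> [? ?]; split; [exact: crng_chart|rewrite chartK]. Qed.

Lemma inv_dom1 : inv_dom x0.
Proof. by split; [exact: crng_chart1|rewrite cinv_chart1 invg1]. Qed.

Lemma conj_dom_chart1 x : inv_dom x -> conj_dom (x, x0).
Proof.
move=> [Wx ix]; split => //=.
  split => //=; first exact: crng_chart1.
  by rewrite cinv_chart1 mulg1; exact: cdom_cinv.
by rewrite cinv_chart1 mulg1 mulgV.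
Qed.

Lemma mul_dom_chart1 x : crng c x -> mul_dom (x, x0) /\ mul_dom (x0, x).
Proof.
move=> Wx; split; split => //=; rewrite ?cinv_chart1 ?mulg1 ?mul1g;
  by [exact: crng_chart1|exact: cdom_cinv].
Qed.

Lemma differentiable_chart_mul p : mul_dom p -> differentiable chart_mul p.
Proof. by have [+ _] := smooth_chart_mul 1; exact. Qed.

Lemma differentiable_chart_conj p : conj_dom p -> differentiable chart_conj p.
Proof. by have [+ _] := smooth_chart_conj 1; exact. Qed.

(** A partial derivative in the second variable is the derivative of [chart_conj] along [(0, v)],
    restricted to the slice of points [(x, x0)]. *)
Lemma smooth_derive_conj v :
  smooth inv_dom (fun x => 'D_v (fun y => chart_conj (x, y)) x0).
Proof.
move=> k; have [_ /(_ (0, v)) DC] := smooth_chart_conj k.+1.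
have : class_C k inv_dom (('D_(0, v) chart_conj) \o (fun x => (x, x0))).
  apply: (class_C_comp _ open_inv_dom _ _ DC); first exact: findim_prod.
  - by move=> x; exact: conj_dom_chart1.
  - apply: class_C_pair; [exact: open_inv_dom|exact: class_C_id|exact: class_C_cst].
apply: eq_class_C; first exact: open_inv_dom.
move=> x; rewrite inE => ix /=; rewrite derive_pairr //.
exact/differentiable_chart_conj/conj_dom_chart1.
Qed.

End LieGroup.

(** * The adjoint representation *)

Lemma derive_comp_fixed (R : realType) n (V : normedModType R)
    (k : 'rV[R]_n -> 'rV[R]_n) (h : 'rV[R]_n -> V) x u :
  k x = x -> differentiable k x -> differentiable h x ->
  'D_u (h \o k) x = 'D_(u *m 'J k x) h x.
Proof.
move=> kx dk dh; have dh' : differentiable h (k x) by rewrite kx.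
by rewrite (derive_comp u dk dh') kx (deriveEjacobian u dk).
Qed.

Section Adjoint.
Context {R : realType} {n : nat} {G : preTopGroupType}.
Local Notation E := 'rV[R]_n.
Variables (A : set (chart G E)) (c : chart G E).
Hypotheses (LG : lie_group A) (Ac : A c) (c1 : cdom c 1%g).
Local Notation ci := (cinv c).
Local Notation x0 := (c 1%g).

(** With row vectors, [v *m adjoint a] is Ad(a) v and [v *m ad u] is the bracket [u, v]. Hence
    [adjoint] reverses products. *)
Definition adjoint (a : G) : 'M[R]_n := 'J (fun y => c (a * ci y * a^-1)%g) x0.
Definition ad (u : E) : 'M[R]_n := 'D_u (fun x => adjoint (ci x)) x0.

Let fE : findim E. Proof. exact: findim_mx. Qed.
Let oC := open_conj_dom LG Ac.

Lemma near_conj_dom a : sym_dom c a -> \forall y \near x0, conj_dom c (c a, y).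
Proof.
move=> sa.
have : conj_dom c (c a, x0) by exact: (conj_dom_chart1 LG Ac c1 (inv_dom_chart LG Ac sa)).
move=> Ca; have nC : nbhs (c a, x0) (conj_dom c).
  by apply: open_nbhs_nbhs; split => //; exact: oC.
have cp : {for x0, continuous (fun y => (c a, y))}.
  by apply: differentiable_continuous; exact: differentiable_pairr.
exact: cp _ nC.
Qed.

Lemma differentiable_conj a : sym_dom c a ->
  differentiable (fun y => c (a * ci y * a^-1)%g) x0.
Proof.
move=> sa; have [ca _] := sa.
have -> : (fun y => c (a * ci y * a^-1)%g) =
    (chart_conj c) \o (fun y => (c a, y)).
  by apply/funext => y; rewrite /chart_conj /= (chartK LG Ac).
apply: differentiable_comp; first exact: differentiable_pairr.
apply: (differentiable_chart_conj LG fE Ac).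
exact: (nbhs_singleton (near_conj_dom sa)).
Qed.

Lemma near_conj_cdom a : sym_dom c a ->
  \forall y \near x0, cdom c (a * ci y * a^-1)%g.
Proof.
move=> sa; apply: filterS (near_conj_dom sa) => y [_ _].
by rewrite /= (chartK LG Ac) //; case: sa.
Qed.

Lemma conj_chart1 a : c (a * ci x0 * a^-1)%g = x0.
Proof. by rewrite (cinv_chart1 LG Ac c1) mulg1 mulgV. Qed.

Lemma adjointM a b : sym_dom c a -> sym_dom c b ->
  adjoint (a * b)%g = adjoint b *m adjoint a.
Proof.
move=> sa sb; have db := differentiable_conj sb.
have da : differentiable (fun y => c (a * ci y * a^-1)%g) (c (b * ci x0 * b^-1)%g).
  by rewrite conj_chart1; exact: differentiable_conj.
have -> : adjoint b *m adjoint a =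
    'J ((fun y => c (a * ci y * a^-1)%g) \o (fun y => c (b * ci y * b^-1)%g)) x0.
  by rewrite (jacobian_comp db da) (conj_chart1 b).
apply/esym/near_eq_jacobian; last exact: differentiable_comp.
apply: filterS (near_conj_cdom sb) => y cy /=.
by rewrite (chartK LG Ac) // invgM !mulgA.
Qed.

Lemma smooth_adjoint : smooth (inv_dom c) (fun x => adjoint (ci x)).
Proof.
move=> k; have oI := open_inv_dom LG Ac.
have : class_C k (inv_dom c) (fun x => 'J (fun y => chart_conj c (x, y)) x0).
  apply: class_C_jacobian => //.
    move=> x ix; apply: (@differentiable_comp _ _ _ _ (fun y => (x, y))).
      exact: differentiable_pairr.
    by apply: (differentiable_chart_conj LG fE Ac) => //; exact: (conj_dom_chart1 LG Ac c1).
  by move=> v; exact: (smooth_derive_conj LG fE Ac c1).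
by [].
Qed.

Lemma adjoint1 : adjoint 1%g = 1%:M.
Proof.
rewrite -(jacobian_id x0) /adjoint; apply/esym/near_eq_jacobian => //.
have : nbhs x0 (crng c).
  apply: open_nbhs_nbhs; split; first exact: (open_crng LG Ac).
  exact: (crng_chart1 LG Ac c1).
by apply: filterS => y cy; rewrite mul1g invg1 mulg1 (cinvK LG Ac).
Qed.

Lemma differentiable_adjoint :
  differentiable (fun x => adjoint (ci x)) x0.
Proof. by have [+ _] := smooth_adjoint 1; apply; exact: (inv_dom1 LG Ac c1). Qed.

(** Ad(a) preserves the bracket. This comes from writing Ad of (a x a^-1) a = a x in two ways and
    differentiating in x at the identity, where conjugation by [a] has a fixed point. *)
Lemma adjoint_ad a u : sym_dom c a ->
  adjoint a *m ad (u *m adjoint a) = ad u *m adjoint a.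
Proof.
move=> sa; have da := differentiable_conj sa.
have dA : differentiable (fun x => adjoint (ci x)) (c (a * ci x0 * a^-1)%g).
  by rewrite conj_chart1; exact: differentiable_adjoint.
pose f := (fun x => adjoint (ci x)) \o (fun y => c (a * ci y * a^-1)%g).
have df : differentiable f x0 by exact: differentiable_comp da dA.
have nI : nbhs x0 (inv_dom c).
  by apply: open_nbhs_nbhs; split; [exact: (open_inv_dom LG Ac)|exact: (inv_dom1 LG Ac c1)].
have nI' : \forall y \near x0, inv_dom c (c (a * ci y * a^-1)%g).
  have cc := differentiable_continuous da.
  by apply: cc; rewrite /= conj_chart1.
have : 'D_u (fun x => adjoint a *m f x) x0 =
       'D_u (fun x => adjoint (ci x) *m adjoint a) x0.
  apply: near_eq_derive.
  apply: filterS3 nI nI' (near_conj_cdom sa) => x ix iy cy.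
  have sy : sym_dom c (a * ci x * a^-1)%g.
    by have := sym_dom_cinv LG Ac iy; rewrite (chartK LG Ac cy).
  have e1 := adjointM sy sa; have e2 := adjointM sa (sym_dom_cinv LG Ac ix).
  rewrite mulgVK in e1.
  rewrite /f /= (chartK LG Ac cy); exact: etrans (esym e1) e2.
have E1 := derive_mulmxl (adjoint a) u df.
have E2 := derive_mulmxr (adjoint a) u differentiable_adjoint.
move=> H; apply: etrans (etrans (etrans _ (esym E1)) H) E2.
apply: (congr1 (mulmx (adjoint a))).
exact: esym (derive_comp_fixed u (conj_chart1 a) da differentiable_adjoint).
Qed.

(** The rows are the left invariant vector fields extending the standard basis of the tangent space
    at the identity. *)
Definition left_mul_mx x : 'M[R]_n := 'J (fun y => chart_mul c (x, y)) x0.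
Definition right_mul_mx x : 'M[R]_n := 'J (fun y => chart_mul c (y, x)) x0.

Lemma differentiable_left_mul x : crng c x ->
  differentiable (fun y => chart_mul c (x, y)) x0.
Proof.
move=> cx; apply: (@differentiable_comp _ _ _ _ (fun y => (x, y)) (chart_mul c)).
  exact: differentiable_pairr.
by apply: (differentiable_chart_mul LG Ac) => //; exact: (mul_dom_chart1 LG Ac c1 cx).1.
Qed.

Lemma differentiable_right_mul x : crng c x ->
  differentiable (fun y => chart_mul c (y, x)) x0.
Proof.
move=> cx; apply: (@differentiable_comp _ _ _ _ (fun y => (y, x)) (chart_mul c)).
  exact: differentiable_pairl.
by apply: (differentiable_chart_mul LG Ac) => //; exact: (mul_dom_chart1 LG Ac c1 cx).2.
Qed.

Lemma chart_mul1l x : crng c x -> chart_mul c (x0, x) = x.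
Proof. by move=> cx; rewrite /chart_mul /= (chartK LG Ac) // mul1g (cinvK LG Ac). Qed.

(** Left translation by an element is conjugation by it followed by right translation: x y = (x y
    x^-1) x. *)
Lemma left_mul_mxE x : inv_dom c x ->
  left_mul_mx x = adjoint (ci x) *m right_mul_mx x.
Proof.
move=> ix; have [cx _] := ix.
have sx := sym_dom_cinv LG Ac ix.
have dc := differentiable_conj sx.
have dr : differentiable (fun y => chart_mul c (y, x))
    (c (ci x * ci x0 * (ci x)^-1)%g).
  by rewrite conj_chart1; exact: differentiable_right_mul.
have := jacobian_comp dc dr; rewrite conj_chart1 => <-.
apply: near_eq_jacobian; last exact: differentiable_left_mul.
apply: filterS (near_conj_cdom sx) => y cy /=.
by rewrite /chart_mul /= (chartK LG Ac) // mulgVK.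
Qed.

End Adjoint.

(** * Left invariant forms and the bracket *)

Section LeftInvariant.
Context {R : realType} {n : nat} {G : preTopGroupType}.
Local Notation E := 'rV[R]_n.
Variables (A : set (chart G E)) (c : chart G E).
Hypotheses (LG : lie_group A) (Ac : A c) (c1 : cdom c 1%g).
Local Notation ci := (cinv c).
Local Notation x0 := (c 1%g).

(** Both sides are second derivatives of [chart_mul] at the unit, along [(v, 0)] and [(0, u)] in the
    two orders. *)
Lemma derive_mul_comm u v :
  'D_u (fun x => 'D_v (fun y => chart_mul c (y, x)) x0) x0 =
  'D_v (fun x => 'D_u (fun y => chart_mul c (x, y)) x0) x0.
Proof.
have cx0 := crng_chart1 LG Ac c1.
have [m0 _] := mul_dom_chart1 LG Ac c1 cx0.
have dm p : mul_dom c p -> differentiable (chart_mul c) p.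
  exact: (differentiable_chart_mul LG Ac).
have nW : \forall x \near x0, crng c x.
  by apply: open_nbhs_nbhs; split => //; exact: (open_crng LG Ac).
have [_ D1] := smooth_chart_mul LG Ac 2.
transitivity ('D_u (fun x => 'D_(v, 0) (chart_mul c) (x0, x)) x0).
  apply: near_eq_derive; apply: filterS nW => x Wx.
  by rewrite derive_pairl //; exact/dm/(mul_dom_chart1 LG Ac c1 Wx).2.
transitivity ('D_v (fun x => 'D_(0, u) (chart_mul c) (x, x0)) x0); last first.
  apply: near_eq_derive; apply: filterS nW => x Wx.
  by rewrite derive_pairr //; exact/dm/(mul_dom_chart1 LG Ac c1 Wx).1.
rewrite (@derive_pairr _ _ _ _ ('D_(v, 0) (chart_mul c))); last first.
  by have [+ _] := D1 (v, 0); exact.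
rewrite (@derive_pairl _ _ _ _ ('D_(0, u) (chart_mul c))); last first.
  by have [+ _] := D1 (0, u); exact.
apply: derive_comm (smooth_chart_mul LG Ac 2); last exact: m0.
exact: (open_mul_dom LG Ac).
Qed.

Lemma differentiable_left_mul_mx : differentiable (left_mul_mx c) x0.
Proof.
suff [+ _] : class_C 1 (crng c) (left_mul_mx c).
  by apply; exact: (crng_chart1 LG Ac c1).
have oW := open_crng LG Ac.
apply: class_C_jacobian => //.
  by move=> x cx; exact: (differentiable_left_mul LG Ac c1).
move=> v.
have DC : class_C 1 (mul_dom c) ('D_(0, v) (chart_mul c)).
  by have [_ H] := smooth_chart_mul LG Ac 2; exact: H.
have : class_C 1 (crng c) (('D_(0, v) (chart_mul c)) \o (fun x => (x, x0))).
  apply: (@class_C_comp _ _ _ _ 1 _ _ _ _ _ oW _ _ DC).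
  - by apply: findim_prod; exact: findim_mx.
  - by move=> x cx; exact: (mul_dom_chart1 LG Ac c1 cx).1.
  - by apply: class_C_pair => //; [exact: class_C_id|exact: class_C_cst].
move=> H; apply: (eq_class_C oW _ H) => x; rewrite inE => cx.
apply/esym/(derive_pairr (f := chart_mul c)).
exact/(differentiable_chart_mul LG Ac)/(mul_dom_chart1 LG Ac c1 cx).1.
Qed.

Lemma differentiable_right_mul_mx : differentiable (right_mul_mx c) x0.
Proof.
suff [+ _] : class_C 1 (crng c) (right_mul_mx c).
  by apply; exact: (crng_chart1 LG Ac c1).
have oW := open_crng LG Ac.
apply: class_C_jacobian => //.
  by move=> x cx; exact: (differentiable_right_mul LG Ac c1).
move=> v.
have DC : class_C 1 (mul_dom c) ('D_(v, 0) (chart_mul c)).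
  by have [_ H] := smooth_chart_mul LG Ac 2; exact: H.
have : class_C 1 (crng c) (('D_(v, 0) (chart_mul c)) \o (fun x => (x0, x))).
  apply: (@class_C_comp _ _ _ _ 1 _ _ _ _ _ oW _ _ DC).
  - by apply: findim_prod; exact: findim_mx.
  - by move=> x cx; exact: (mul_dom_chart1 LG Ac c1 cx).2.
  - by apply: class_C_pair => //; [exact: class_C_cst|exact: class_C_id].
move=> H; apply: (eq_class_C oW _ H) => x; rewrite inE => cx.
apply/esym/(derive_pairl (f := chart_mul c)).
exact/(differentiable_chart_mul LG Ac)/(mul_dom_chart1 LG Ac c1 cx).2.
Qed.

Lemma near_crng : \forall x \near x0, crng c x.
Proof.
apply: open_nbhs_nbhs; split; first exact: (open_crng LG Ac).
exact: (crng_chart1 LG Ac c1).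
Qed.

Lemma right_mul_mx1 : right_mul_mx c x0 = 1%:M.
Proof.
rewrite -(jacobian_id x0) /right_mul_mx; apply/esym/near_eq_jacobian => //.
apply: filterS near_crng => y cy.
by rewrite /chart_mul /= (cinv_chart1 LG Ac c1) mulg1 (cinvK LG Ac).
Qed.

(** The right-hand side is the bracket of left invariant fields at the unit. Differentiating L = Ad
    R there gives D_u L = [ad c u] + D_u R, and the symmetry of second derivatives trades the term
    with R for one with L and u, v exchanged. *)
Lemma ad_bracket u v :
  v *m ad c u = v *m 'D_u (left_mul_mx c) x0 - u *m 'D_v (left_mul_mx c) x0.
Proof.
have dL := differentiable_left_mul_mx; have dR := differentiable_right_mul_mx.
have dA := differentiable_adjoint LG Ac c1.
have e1 : 'D_u (left_mul_mx c) x0 = ad c u + 'D_u (right_mul_mx c) x0.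
  transitivity ('D_u (fun x => adjoint c (ci x) *m right_mul_mx c x) x0).
    apply: near_eq_derive.
    have nI : nbhs x0 (inv_dom c).
      apply: open_nbhs_nbhs; split; first exact: (open_inv_dom LG Ac).
      exact: (inv_dom1 LG Ac c1).
    by apply: filterS nI => x ix; exact: (left_mul_mxE LG Ac c1).
  apply: etrans (derive_mulmx u dA dR) _.
  rewrite right_mul_mx1 mulmx1 (cinv_chart1 LG Ac c1) (adjoint1 LG Ac c1) mul1mx.
  by [].
have e2 : v *m 'D_u (right_mul_mx c) x0 = u *m 'D_v (left_mul_mx c) x0.
  apply: etrans (esym (derive_mulmxl v u dR)) _.
  apply: etrans _ (derive_mulmxl u v dL).
  transitivity ('D_u (fun x => 'D_v (fun y => chart_mul c (y, x)) x0) x0).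
    apply: near_eq_derive; apply: filterS near_crng => x cx; apply/esym.
    exact: (deriveEjacobian _ (differentiable_right_mul LG Ac c1 cx)).
  apply: etrans (derive_mul_comm u v) _.
  apply: near_eq_derive; apply: filterS near_crng => x cx.
  exact: (deriveEjacobian _ (differentiable_left_mul LG Ac c1 cx)).
apply/esym/(etrans (congr2 (fun a b => v *m a - b) e1 (esym e2))).
by rewrite mulmxDr; exact: addrK.
Qed.

Definition form_col (w : form1 G E) (x : E) : 'cV[R]_n :=
  \col_i w c x (delta_mx 0 i).

Lemma form_colE w x v : is_form1 A w -> crng c x ->
  w c x v = (v *m form_col w x) 0 0.
Proof.
move=> [lw _ _] cx; have lwx := lw c x Ac cx.
rewrite {1}(row_sum_delta v) -[w c x]/(linear_of lwx : _ -> _) linear_sum mxE.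
by apply: eq_bigr => i _; rewrite linearZ mxE.
Qed.

Lemma differentiable_form_col w : is_form1 A w -> differentiable (form_col w) x0.
Proof.
move=> [_ sw _]; suff [+ _] : class_C 1 (crng c) (form_col w).
  by apply; exact: (crng_chart1 LG Ac c1).
have oW := open_crng LG Ac.
apply: class_C_mx => // i j.
have := sw c (delta_mx 0 i) Ac 1; apply: eq_class_C => // x _.
by rewrite mxE.
Qed.

(** Invariance under left translation by [ci x], evaluated at the unit and written with the
    coefficient column of the form. *)
Lemma left_invariant_col w x : left_invariant A w -> crng c x ->
  left_mul_mx c x *m form_col w x = form_col w x0.
Proof.
move=> [fw lw] cx; apply: mulmx_inj => v; rewrite mulmxA.
have cx0 := crng_chart1 LG Ac c1.
have := lw (ci x) c c x0 v Ac Ac cx0.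
rewrite (cinv_chart1 LG Ac c1) mulg1 (cinvK LG Ac cx) => /(_ (cdom_cinv LG Ac cx)).
have := deriveEjacobian v (differentiable_left_mul LG Ac c1 cx).
rewrite /left_mul_mx /chart_mul /= => ->.
rewrite !(form_colE _ fw) // => H.
by apply/matrixP => i j; rewrite !ord1.
Qed.

(** The Maurer-Cartan formula dw(u, v) = - w([u, v]) at the unit. It follows by differentiating the
    constancy of [left_mul_mx] times [form_col], which expresses the derivatives of the form by
    those of left translation. *)
Lemma ext_d_ad w u v : left_invariant A w ->
  ext_d w c x0 u v = - w c x0 (v *m ad c u).
Proof.
move=> /[dup] lw [fw _]; have cx0 := crng_chart1 LG Ac c1.
have dF := differentiable_form_col fw; have dL := differentiable_left_mul_mx.
have e a b : 'D_a (fun y => w c y b) x0 =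
    (b *m 'D_a (form_col w) x0) 0 0.
  rewrite -(derive_mulmxl b a dF) derive_coord_mx; last first.
    have dm : differentiable (mulmx b : 'cV[R]_n -> 'M[R]_1) (form_col w x0).
      apply: (@linear_differentiable _ _ _ (mulmx b)).
      exact: findim_linear_continuous (findim_mx _ _).
    exact: (@differentiable_comp _ _ _ _ (form_col w) (mulmx b)).
  apply: near_eq_derive; apply: filterS near_crng => x cx; exact: form_colE.
have e0 a : 'D_a (form_col w) x0 = - ('D_a (left_mul_mx c) x0 *m form_col w x0).
  have : 'D_a (fun x => left_mul_mx c x *m form_col w x) x0 = 0.
    rewrite -[RHS](derive_cst (form_col w x0) x0 a).
    apply: near_eq_derive; apply: filterS near_crng => x cx.
    exact: left_invariant_col.
  rewrite (derive_mulmx a dL dF).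
  have -> : left_mul_mx c x0 = 1%:M.
    rewrite -(jacobian_id x0); apply/esym/near_eq_jacobian => //.
    by apply: filterS near_crng => y cy; rewrite (chart_mul1l LG Ac c1).
  by rewrite mul1mx addrC => /eqP; rewrite addr_eq0 => /eqP.
rewrite /ext_d !e !e0 (form_colE _ fw cx0) ad_bracket mulmxBl !mulmxN !mulmxA.
have ent (B C : 'M[R]_1) : (- B) 0 0 - (- C) 0 0 = - (B - C) 0 0.
  by rewrite !mxE opprK opprB addrC.
exact: ent.
Qed.

End LeftInvariant.

(** * Automorphisms of sl(2) and sl(2) x sl(2) *)

Section Sl2.
Context {R : realFieldType}.
Implicit Types (h e f X Y : 'M[R]_2).

Local Notation E11 := (delta_mx 0 0 : 'M[R]_2).
Local Notation E12 := (delta_mx 0 1 : 'M[R]_2).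
Local Notation E21 := (delta_mx 1 0 : 'M[R]_2).
Local Notation E22 := (delta_mx 1 1 : 'M[R]_2).

Lemma mx2P X Y : X 0 0 = Y 0 0 -> X 0 1 = Y 0 1 -> X 1 0 = Y 1 0 ->
  X 1 1 = Y 1 1 -> X = Y.
Proof.
move=> e00 e01 e10 e11; apply/matrixP => i j.
case: (unliftP 0 i) => [i' ->|->]; case: (unliftP 0 j) => [j' ->|->];
  rewrite ?(ord1 i') ?(ord1 j') //.
- by have -> : lift 0 0 = 1 :> 'I_2 by apply/val_inj.
- by have -> : lift 0 0 = 1 :> 'I_2 by apply/val_inj.
- by have -> : lift 0 0 = 1 :> 'I_2 by apply/val_inj.
Qed.

Lemma sum2 (F : 'I_2 -> R) : \sum_i F i = F 0 + F 1.
Proof.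
rewrite big_ord_recl big_ord1; congr (_ + F _).
by apply/val_inj.
Qed.

Lemma mul2E X Y i j : (X * Y) i j = X i 0 * Y 0 j + X i 1 * Y 1 j.
Proof. by rewrite mxE sum2. Qed.

Lemma tr2E X : \tr X = X 0 0 + X 1 1.
Proof. by rewrite /mxtrace sum2. Qed.

(* Polarized Cayley-Hamilton identity for traceless matrices. *)
Lemma anticommutator_tr X Y : \tr X = 0 -> \tr Y = 0 ->
  X * Y + Y * X = (\tr (X * Y))%:M.
Proof.
rewrite !tr2E => /eqP; rewrite addr_eq0 => /eqP x0 /eqP.
rewrite addr_eq0 => /eqP y0.
rewrite !mul2E; apply: mx2P; rewrite mxE !mul2E [RHS]mxE /= ?x0 ?y0 ?mulr1n ?mulr0n; ring.
Qed.

Lemma mx_double_eq0 X : X + X = 0 -> X = 0.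
Proof.
rewrite -mulr2n => /eqP; rewrite -scaler_nat scaler_eq0 pnatr_eq0 /=.
by move=> /eqP.
Qed.

Lemma tr_mulC X Y : \tr (X * Y) = \tr (Y * X).
Proof. exact: mxtrace_mulC. Qed.

Lemma tr_commutator X Y : \tr (X * Y - Y * X) = 0.
Proof. by rewrite raddfB /= tr_mulC subrr. Qed.

(** * Associative relations forced on 2x2 matrices by the commutators of an sl(2) triple *)

Section Triple.
Variables (h e f : 'M[R]_2).
Hypotheses (he : h * e - e * h = e + e) (hf : h * f - f * h = - (f + f))
  (ef : e * f - f * e = h) (e0 : e != 0).

Let tre : \tr e = 0.
Proof.
have := tr_commutator h e; rewrite he raddfD /= => /eqP.
by rewrite -mulr2n mulrn_eq0 /= => /eqP.
Qed.

Let trf : \tr f = 0.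
Proof.
have := tr_commutator h f; rewrite hf raddfN raddfD /= => /eqP.
by rewrite oppr_eq0 -mulr2n mulrn_eq0 /= => /eqP.
Qed.

Let trh : \tr h = 0. Proof. by rewrite -ef tr_commutator. Qed.

(** The traces of h [h, Y] and Y [h, Y] vanish by cyclicity. Thus an eigenvector of ad h with
    nonzero eigenvalue is isotropic and orthogonal to [h] for the trace form. *)
Let tr0 Y (c : R) : \tr Y = 0 -> c != 0 -> h * Y - Y * h = c *: Y ->
  \tr (h * Y) = 0 /\ \tr (Y * Y) = 0.
Proof.
move=> tY c0 hY.
have t1 : \tr (h * (h * Y - Y * h)) = 0.
  by rewrite mulrBr raddfB /= [X in X - _]tr_mulC -mulrA subrr.
have t2 : \tr (Y * (h * Y - Y * h)) = 0.
  by rewrite mulrBr raddfB /= [X in _ - X]tr_mulC mulrA subrr.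
move: t1 t2; rewrite hY -!scalerAr !mxtraceZ => /eqP + /eqP.
by rewrite !mulf_eq0 (negbTE c0) /= => /eqP -> /eqP ->.
Qed.

Let he' : h * e - e * h = 2 *: e. Proof. by rewrite he -mulr2n scaler_nat. Qed.
Let hf' : h * f - f * h = - 2 *: f.
Proof. by rewrite hf -mulr2n scaleNr scaler_nat. Qed.
Let n2 : (2 : R) != 0. Proof. by rewrite pnatr_eq0. Qed.
Let nN2 : (- 2 : R) != 0. Proof. by rewrite oppr_eq0. Qed.

Let half_eq X Y : X + X = Y + Y -> X = Y.
Proof.
by move=> H; apply/subr0_eq/mx_double_eq0; rewrite addrACA -opprD H subrr.
Qed.

(** By orthogonality for the trace form [h] and [e] anticommute, so the commutator 2 e is twice the
    product. *)
Lemma triple_he : h * e = e /\ e * h = - e.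
Proof.
have [t _] := tr0 tre n2 he'.
have := anticommutator_tr trh tre; rewrite t raddf0 => /eqP.
rewrite addrC addr_eq0 => /eqP eh; have := he.
by rewrite eh opprK => /half_eq ->.
Qed.

Lemma triple_hf : h * f = - f /\ f * h = f.
Proof.
have [t _] := tr0 trf nN2 hf'.
have := anticommutator_tr trh trf; rewrite t raddf0 => /eqP.
rewrite addrC addr_eq0 => /eqP fh; have := hf.
by rewrite fh opprK opprD => /half_eq ->; rewrite opprK.
Qed.

Lemma triple_ee : e * e = 0 /\ f * f = 0.
Proof.
have [_ te] := tr0 tre n2 he'; have [_ tf] := tr0 trf nN2 hf'.
by split; apply: mx_double_eq0; rewrite anticommutator_tr // ?te ?tf raddf0.
Qed.

(** The anticommutator is a scalar t by polarized Cayley-Hamilton. Multiplying by [e] on the right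
    gives t e = e, and [e] is nonzero. *)
Lemma triple_ef : e * f + f * e = 1.
Proof.
have [ee ff] := triple_ee; have [hee _] := triple_he.
have efe : e * f * e = e.
  by rewrite -[RHS]hee -ef mulrBl -[f * e * e]mulrA ee mulr0 subr0.
have := anticommutator_tr tre trf; set t := \tr _ => eft; rewrite eft.
have : t%:M * e = e.
  by rewrite -eft mulrDl efe -mulrA ee mulr0 addr0.
rewrite -[t%:M * e]/(t%:M *m e) mul_scalar_mx => te.
have : (t - 1) *: e = 0 by rewrite scalerBl scale1r te subrr.
by move/eqP; rewrite scaler_eq0 (negbTE e0) orbF subr_eq0 => /eqP ->.
Qed.

Lemma triple_hh : h * h = 1.
Proof.
have [_ eh] := triple_he; have [_ fh] := triple_hf.
rewrite -{1}ef mulrBl -!mulrA fh eh mulrN opprK; exact: triple_ef.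
Qed.

(* The image of the matrix units under the algebra automorphism extending the
   triple, multiplied by the matrix units and summed: it intertwines the triple
   with the standard one. *)
Definition intertwiner : 'M[R]_2 := e * f * E11 + f * E12.

Lemma intertwiner_h : h * intertwiner = intertwiner * (E11 - E22).
Proof.
have [he1 _] := triple_he; have [hf1 _] := triple_hf.
rewrite /intertwiner mulrDr !mulrA he1 hf1 mulrDl -!mulrA !mulrBr.
have -> : E11 * E11 = E11 by rewrite -[LHS]/(E11 *m E11) mul_delta_mx.
have -> : E11 * E22 = 0 by rewrite -[LHS]/(E11 *m E22) mul_delta_mx_0.
have -> : E12 * E11 = 0 by rewrite -[LHS]/(E12 *m E11) mul_delta_mx_0.
have -> : E12 * E22 = E12 by rewrite -[LHS]/(E12 *m E22) mul_delta_mx.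
by rewrite !mulr0 subr0 sub0r mulNr.
Qed.

Lemma intertwiner_e : e * intertwiner = intertwiner * E12.
Proof.
have [ee _] := triple_ee.
rewrite /intertwiner mulrDr !mulrA ee !mul0r add0r mulrDl -!mulrA.
have -> : E11 * E12 = E12 by rewrite -[LHS]/(E11 *m E12) mul_delta_mx.
have -> : E12 * E12 = 0 by rewrite -[LHS]/(E12 *m E12) mul_delta_mx_0.
by rewrite !mulr0 addr0.
Qed.

Lemma intertwiner_f : f * intertwiner = intertwiner * E21.
Proof.
have [_ ff] := triple_ee.
have fef : f * e * f = f.
  have -> : f * e = 1 - e * f by rewrite -triple_ef addrC addKr.
  by rewrite mulrBl mul1r -mulrA ff mulr0 subr0.
rewrite /intertwiner mulrDr !mulrA fef ff mul0r addr0 mulrDl -!mulrA.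
have -> : E11 * E21 = 0 by rewrite -[LHS]/(E11 *m E21) mul_delta_mx_0.
have -> : E12 * E21 = E11 by rewrite -[LHS]/(E12 *m E21) mul_delta_mx.
by rewrite !mulr0 add0r.
Qed.

(** Commuting with [h] makes the anticommutator 2 h X a scalar, so 2 X is a multiple of [h] because
    h^2 = 1. Since h e = e and e h = - e, a multiple of [h] commuting with [e] is 0. *)
Lemma triple_centralizer X : \tr X = 0 -> h * X = X * h -> e * X = X * e -> X = 0.
Proof.
move=> tX hX eX; have [he1 eh1] := triple_he.
have := anticommutator_tr trh tX; set t := \tr _; rewrite -hX => ht.
have Xh : X + X = t *: h.
  have := congr1 (fun M => h * M) ht.
  rewrite mulrDr !mulrA triple_hh !mul1r => ->.
  by rewrite -[h * _]/(h *m _) mul_mx_scalar.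
have : e * (X + X) = (X + X) * e by rewrite mulrDr mulrDl eX.
rewrite Xh -scalerAr -scalerAl he1 eh1 scalerN => H.
have /mx_double_eq0/eqP : t *: e + t *: e = 0 by rewrite -{1}H addNr.
rewrite scaler_eq0 (negbTE e0) orbF => /eqP t0.
by apply: mx_double_eq0; rewrite Xh t0 scale0r.
Qed.

End Triple.
End Sl2.

(** * Projective coordinates of 2x2 matrices *)

Section ProjectiveCoordinates.
Context {R : realType}.

(** Affine coordinates on the projective space of matrices, meaningful where the entry (0, 0) is
    nonzero. *)
Definition proj_coord (M : 'M[R]_2) : 'rV[R]_3 :=
  \row_j nth 0 [:: M 0 1 / M 0 0; M 1 0 / M 0 0; M 1 1 / M 0 0] j.

Lemma proj_coordZ (a : R) (M : 'M[R]_2) : a != 0 -> proj_coord (a *: M) = proj_coord M.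
Proof.
move=> a0; apply/rowP => j; rewrite !mxE.
have e x y : a * x / (a * y) = x / y by rewrite -mulf_div divff // mul1r.
by rewrite !e.
Qed.

Lemma proj_coord_inj (M N : 'M[R]_2) : M 0 0 != 0 -> N 0 0 != 0 ->
  proj_coord M = proj_coord N -> N = (N 0 0 / M 0 0) *: M.
Proof.
move=> m0 n0 /rowP e.
have := e 0; have := e 1; have := e 2%:R; rewrite !mxE /= => e2 e1 e0.
apply: mx2P; rewrite mxE.
- by rewrite divfK.
- by rewrite mulrAC -mulrA e0 mulrC divfK.
- by rewrite mulrAC -mulrA e1 mulrC divfK.
- by rewrite mulrAC -mulrA e2 mulrC divfK.
Qed.

Lemma class_C_proj_coord (E : normedModType R) k (W : set E) (f : E -> 'M[R]_2) :
  open W -> (forall x, W x -> f x 0 0 != 0) -> class_C k W f ->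
  class_C k W (proj_coord \o f).
Proof.
move=> oW f0 Cf; apply: class_C_mx => // i j.
have H a b : class_C k W (fun x => f x a b / f x 0 0 : R^o).
  apply: class_CM => //; first exact: class_C_coord.
  by apply: class_CV => //; exact: class_C_coord.
have [j0|[j1|j2]] : j = 0 \/ j = 1 \/ j = 2%:R.
  case: j => -[|[|[|//]]] p; [left|right; left|right; right]; exact/val_inj.
- apply: eq_class_C (H 0 1) => // x _; by rewrite mxE j0.
- apply: eq_class_C (H 1 0) => // x _; by rewrite mxE j1.
- apply: eq_class_C (H 1 1) => // x _; by rewrite mxE j2.
Qed.

Lemma derive_div1 (E : normedModType R) (f g : E -> R^o) x v :
  differentiable f x -> differentiable g x -> g x = 1 ->
  'D_v (fun y => f y / g y : R^o) x = 'D_v f x - f x * 'D_v g x.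
Proof.
move=> df dg gx.
have g0 : g x != 0 by rewrite gx oner_neq0.
have dG : derivable g x v by exact: diff_derivable.
have dV : derivable (fun y => (g y)^-1) x v.
  exact: derivableV.
have dF : derivable f x v by exact: diff_derivable.
have := @deriveM _ _ f (fun y => (g y)^-1) x v dF dV.
rewrite (deriveV g0 dG).
rewrite gx expr1n invr1 scaleN1r scalerN scale1r => e.
by apply: etrans e _; rewrite addrC.
Qed.

(** At a point where [f] is the identity, the quotient rule subtracts from the entry (a, b) of the
    derivative the entry (0, 0) if a = b, and nothing otherwise. So only scalar directions are
    lost. *)
Lemma derive_proj_coord (E : normedModType R) (f : E -> 'M[R]_2) x v :
  differentiable f x -> f x = 1 -> differentiable (proj_coord \o f) x ->
  'D_v (proj_coord \o f) x = 0 -> 'D_v f x = (('D_v f x) 0 0)%:M.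
Proof.
move=> df fx dq /rowP q0.
have dc a b : differentiable (fun y => f y a b : R^o) x.
  exact: (@differentiable_comp _ _ _ _ f (fun M : 'M[R]_2 => M a b : R^o) x df
    (differentiable_coord _ _ _)).
have fx1 : f x 0 0 = 1 by rewrite fx mxE.
have D a b : 'D_v (fun y => f y a b / f y 0 0 : R^o) x =
    ('D_v f x) a b - (a == b)%:R * ('D_v f x) 0 0.
  by rewrite derive_div1 // -!derive_coord_mx // fx mxE.
have Q j : 'D_v (fun y => (proj_coord (f y)) 0 j : R^o) x = 0.
  by have := q0 j; rewrite derive_coord_mx // mxE.
have Q0 := Q 0; have Q1 := Q 1; have Q2 := Q 2%:R.
have e0 : (fun y => (proj_coord (f y)) 0 0 : R^o) = (fun y => f y 0 1 / f y 0 0).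
  by apply/funext => y; rewrite mxE.
have e1 : (fun y => (proj_coord (f y)) 0 1 : R^o) = (fun y => f y 1 0 / f y 0 0).
  by apply/funext => y; rewrite mxE.
have e2 : (fun y => (proj_coord (f y)) 0 2%:R : R^o) = (fun y => f y 1 1 / f y 0 0).
  by apply/funext => y; rewrite mxE.
rewrite e0 D mul0r subr0 in Q0; rewrite e1 D mul0r subr0 in Q1.
rewrite e2 D mul1r in Q2.
apply: mx2P; rewrite [RHS]mxE /= ?mulr1n ?mulr0n //.
exact/subr0_eq.
Qed.

End ProjectiveCoordinates.

(** * Algebras identified with pairs of traceless matrices: center, automorphisms, intertwiners *)

Section Sl2Sl2.
Context {R : realType} {n : nat}.
Local Notation E := 'rV[R]_n.
Local Notation H := (delta_mx 0 0 - delta_mx 1 1 : 'M[R]_2).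
Local Notation E12 := (delta_mx 0 1 : 'M[R]_2).
Local Notation E21 := (delta_mx 1 0 : 'M[R]_2).
Variables (T : bool -> E -> 'M[R]_2) (br : E -> E -> E).
Hypotheses (Tlin : forall i, linear (T i))
  (Tbr : forall i u v, T i (br u v) = T i u * T i v - T i v * T i u)
  (Ttr : forall i v, \tr (T i v) = 0)
  (Tinj : forall v, (forall i, T i v = 0) -> v = 0)
  (Tsurj : forall M : bool -> 'M[R]_2, (forall i, \tr (M i) = 0) ->
    exists v, forall i, T i v = M i).

Let TB i u v : T i (u - v) = T i u - T i v.
Proof. exact: (raddfB (linear_of (Tlin i))). Qed.
Let TD i u v : T i (u + v) = T i u + T i v.
Proof. exact: (raddfD (linear_of (Tlin i))). Qed.
Let TZ i a v : T i (a *: v) = a *: T i v.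
Proof. exact: (linearZ_LR (linear_of (Tlin i))). Qed.

Lemma sl2sl2_ext u v : (forall i, T i u = T i v) -> u = v.
Proof. by move=> e; apply/subr0_eq/Tinj => i; rewrite TB e subrr. Qed.

Lemma std_triple : [/\ H * E12 - E12 * H = E12 + E12,
  H * E21 - E21 * H = - (E21 + E21), E12 * E21 - E21 * E12 = H & E12 != 0].
Proof.
split.
- by apply: mx2P; rewrite !(mul2E, mxE) /=; ring.
- by apply: mx2P; rewrite !(mul2E, mxE) /=; ring.
- by apply: mx2P; rewrite !(mul2E, mxE) /=; ring.
- by apply/eqP => /matrixP/(_ 0 1) /eqP; rewrite !mxE /= oner_eq0.
Qed.


Lemma std_vectors : exists hv ev fv : bool -> E, forall i j,
  [/\ T i (hv j) = (i == j)%:R *: H, T i (ev j) = (i == j)%:R *: E12 &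
      T i (fv j) = (i == j)%:R *: E21].
Proof.
have V (M : 'M[R]_2) : \tr M = 0 ->
    exists w : bool -> E, forall i j, T i (w j) = (i == j)%:R *: M.
  move=> tM; have S j : exists v, forall i, T i v = (i == j)%:R *: M.
    by apply: Tsurj => i; rewrite mxtraceZ tM mulr0.
  have [w wP] := choice S; by exists w => i j; exact: wP.
have [hv hP] : exists w : bool -> E, forall i j, T i (w j) = (i == j)%:R *: H.
  by apply: V; rewrite tr2E !mxE /=; ring.
have [ev eP] : exists w : bool -> E, forall i j, T i (w j) = (i == j)%:R *: E12.
  by apply: V; rewrite tr2E !mxE /=; ring.
have [fv fP] : exists w : bool -> E, forall i j, T i (w j) = (i == j)%:R *: E21.
  by apply: V; rewrite tr2E !mxE /=; ring.
by exists hv, ev, fv.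
Qed.

Lemma traceless_decomp (M : 'M[R]_2) : \tr M = 0 ->
  M = M 0 0 *: H + M 0 1 *: E12 + M 1 0 *: E21.
Proof.
rewrite tr2E addrC => /eqP; rewrite addr_eq0 => /eqP e.
by apply: mx2P; rewrite !mxE /= ?e; ring.
Qed.

Lemma commutant_scalar (M : 'M[R]_2) : (forall X, \tr X = 0 -> M * X = X * M) ->
  M = (M 0 0)%:M.
Proof.
move=> cM.
have /cM/matrixP cH : \tr H = 0 by rewrite tr2E !mxE /=; ring.
have /cM/matrixP cE : \tr E12 = 0 by rewrite tr2E !mxE /=; ring.
(* Commuting with H kills the off-diagonal entries; commuting with E12 equates the diagonal ones. *)
have h01 := cH 0 1; have h10 := cH 1 0; have e01 := cE 0 1.
rewrite !mul2E !mxE /= in h01 h10 e01.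
by apply: mx2P; rewrite !mxE /=; lra.
Qed.

(** Each component of [u] centralizes the standard triple. This triviality of the center later
    yields the injectivity of the differential of the coordinates. *)
Lemma sl2sl2_center u : (forall i v, T i (br u v) = 0) -> u = 0.
Proof.
move=> u0; have [hv [ev [fv vP]]] := std_vectors.
have [s1 s2 s3 s4] := std_triple.
apply: Tinj => i; apply: (triple_centralizer s1 s2 s3 s4) => //.
  have [e _ _] := vP i i; rewrite eqxx scale1r in e.
  by have := u0 i (hv i); rewrite Tbr e => /subr0_eq.
have [_ e _] := vP i i; rewrite eqxx scale1r in e.
by have := u0 i (ev i); rewrite Tbr e => /subr0_eq.
Qed.

Section Automorphism.
Variables (hv ev fv : bool -> E) (phi : E -> E).
Hypotheses (vP : forall i j,
  [/\ T i (hv j) = (i == j)%:R *: H, T i (ev j) = (i == j)%:R *: E12 &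
      T i (fv j) = (i == j)%:R *: E21])
  (philin : linear phi) (phibr : forall u v, phi (br u v) = br (phi u) (phi v))
  (phi0 : forall i, T i (phi (ev i)) != 0).

Let pD u v : phi (u + v) = phi u + phi v.
Proof. exact: (raddfD (linear_of philin)). Qed.
Let pN u : phi (- u) = - phi u.
Proof. exact: (raddfN (linear_of philin)). Qed.
Let pZ a v : phi (a *: v) = a *: phi v.
Proof. exact: (linearZ_LR (linear_of philin)). Qed.
Let TN i u : T i (- u) = - T i u.
Proof. exact: (raddfN (linear_of (Tlin i))). Qed.

Lemma automorphism_triple i :
  let h := T i (phi (hv i)) in let e := T i (phi (ev i)) in
  let f := T i (phi (fv i)) in
  [/\ h * e - e * h = e + e, h * f - f * h = - (f + f) & e * f - f * e = h].
Proof.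
have [s1 s2 s3 _] := std_triple.
have c (a : bool) (X Y : 'M[R]_2) : a%:R *: X * (a%:R *: Y) - a%:R *: Y * (a%:R *: X) =
    a%:R *: (X * Y - Y * X).
  by case: a; rewrite ?scale1r // !scale0r !mulr0 subrr.
move=> h e f; rewrite /h /e /f; split.
- rewrite -Tbr -phibr -TD -pD; congr (T _ (phi _)).
  apply: sl2sl2_ext => j; have [eh ee _] := vP j i.
  rewrite Tbr TD eh ee c.
  by rewrite s1 scalerDr.
- rewrite -Tbr -phibr -TD -pD -TN -pN; congr (T _ (phi _)).
  apply: sl2sl2_ext => j; have [eh _ ef] := vP j i.
  rewrite Tbr TN TD eh ef c.
  by rewrite s2 scalerN scalerDr.
- rewrite -Tbr -phibr; congr (T _ (phi _)).
  apply: sl2sl2_ext => j; have [eh ee ef] := vP j i.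
  rewrite Tbr eh ee ef c.
  by rewrite s3.
Qed.

(** [w] commutes with the standard vectors of the factor i, so the component i of [phi w]
    centralizes their images. These form a triple that is nonzero by [phi0], the hypothesis that
    excludes an exchange of the two factors. *)
Lemma automorphism_ideal i w : T i w = 0 -> T i (phi w) = 0.
Proof.
move=> w0; have [t1 t2 t3] := automorphism_triple i.
have ideal u : (forall j, j != i -> T j u = 0) ->
    T i (phi u) * T i (phi w) = T i (phi w) * T i (phi u).
  move=> u0; apply/subr0_eq; rewrite -Tbr -phibr.
  have -> : br u w = 0.
    apply: Tinj => j; rewrite Tbr; have [->|ji] := eqVneq j i.
      by rewrite w0 mulr0 mul0r subrr.
    by rewrite (u0 j ji) mulr0 mul0r subrr.
  by have := pZ 0 0; rewrite !scale0r => ->; have := TZ i 0 0; rewrite !scale0r.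
apply: (triple_centralizer t1 t2 t3 (phi0 i)) => //; apply: ideal => j ji.
  by have [-> _ _] := vP j i; rewrite (negbTE ji) scale0r.
by have [_ -> _] := vP j i; rewrite (negbTE ji) scale0r.
Qed.

(** Up to the kernel of [T i], which [phi] preserves, [v] is a combination of the standard triple of
    the factor i, and on that triple the identity is the intertwining property of [P]. *)
Lemma automorphism_intertwiner i v :
  let P := intertwiner (T i (phi (ev i))) (T i (phi (fv i))) in
  T i (phi v) * P = P * T i v.
Proof.
move=> P; have [t1 t2 t3] := automorphism_triple i.
have t4 := phi0 i.
have [eh ee ef] := vP i i; rewrite eqxx !scale1r in eh ee ef.
set M := T i v.
pose w := M 0 0 *: hv i + M 0 1 *: ev i + M 1 0 *: fv i.
have Tw : T i w = M.
  by rewrite /w !TD !TZ eh ee ef -traceless_decomp // /M Ttr.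
have /automorphism_ideal : T i (v - w) = 0 by rewrite TB Tw subrr.
rewrite pD pN TD TN => /subr0_eq ->.
rewrite /w !pD !pZ !TD !TZ [LHS]mulrDl [X in X + _]mulrDl -!scalerAl.
rewrite (intertwiner_h t1 t2 t3) (intertwiner_e t1 t2)
  (intertwiner_f t1 t2 t3 t4).
have eM : M = M 0 0 *: H + M 0 1 *: E12 + M 1 0 *: E21.
  exact: traceless_decomp (Ttr i v).
have eQ (Q : 'M[R]_2) : M 0 0 *: (Q * H) + M 0 1 *: (Q * E12) +
    M 1 0 *: (Q * E21) = Q * M.
  by rewrite [in RHS]eM !mulrDr -!scalerAr !mulrDr.
exact: eQ.
Qed.

End Automorphism.

(** Schur's lemma: the quotient P^-1 P' commutes with all traceless matrices, hence is scalar. *)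
Lemma intertwiner_unique i (L : E -> 'M[R]_2) (P P' : 'M[R]_2) : P \is a GRing.unit ->
  (forall v, L v * P = P * T i v) -> (forall v, L v * P' = P' * T i v) ->
  exists a, P' = a *: P.
Proof.
move=> uP LP LP'; pose Q := P^-1 * P'.
have cQ X : \tr X = 0 -> Q * X = X * Q.
  move=> tX; have [|v vX] := Tsurj (M := fun=> X) => //.
  rewrite /Q -mulrA -(vX i) -LP' mulrA.
  have -> : P^-1 * L v = T i v * P^-1.
    by apply: (mulIr uP); rewrite -mulrA LP mulrA mulVr // mul1r mulrVK.
  by rewrite mulrA.
exists (Q 0 0); have -> : P' = P * Q by rewrite /Q mulrA divrr // mul1r.
by rewrite [in LHS](commutant_scalar cQ) -[LHS]/(P *m _) mul_mx_scalar.
Qed.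

End Sl2Sl2.

(** * Local isomorphisms from charts *)

Section CompatibleCharts.
Context {R : realType}.

(** A chart of the maximal atlas, except that its model space may differ from that of [A]: the group
    of dimension 6 will receive a chart with values in a product of two spaces of dimension 3. *)
Definition compatible_chart (T : topologicalType) (E F : normedModType R)
    (A : set (chart T E)) (k : chart T F) : Prop :=
  is_chart k /\ forall c, A c ->
    smooth [set x | crng c x /\ cdom k (cinv c x)] (fun x => k (cinv c x)) /\
    smooth [set y | crng k y /\ cdom c (cinv k y)] (fun y => c (cinv k y)).

Lemma smooth_transition (T : topologicalType) (E : normedModType R)
    (A : set (chart T E)) c d : smooth_atlas A -> A c -> A d ->
  smooth [set x | crng c x /\ cdom d (cinv c x)] (fun x => d (cinv c x)).
Proof.
move=> [_ _ [_ H]] Ac Ad k.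
by apply: class_C_subset (H c d Ac Ad k) => x [].
Qed.

Lemma open_crng_preimage (T : topologicalType) (F : normedModType R)
    (k : chart T F) (D : set T) : is_chart k -> open D ->
  open [set y | crng k y /\ D (cinv k y)].
Proof.
case=> -[_ oc] _ _ [_ cc] oD.
exact: (@open_preimage_in _ _ (crng k) (cinv k)).
Qed.

Lemma compatible_chart_of_inverse (T : topologicalType) (E F : normedModType R)
    (A : set (chart T E)) (c : chart T E) (U : set E) (V : set F)
    (h : E -> F) (g : F -> E) : findim E -> findim F ->
  smooth_atlas A -> A c -> open U -> U `<=` crng c -> open V ->
  set_fun U V h -> set_fun V U g -> {in U, cancel h g} -> {in V, cancel g h} ->
  smooth U h -> smooth V g ->
  compatible_chart A
    (Chart (cdom c `&` c @^-1` U) V (fun a => h (c a)) (fun y => cinv c (g y))).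
Proof.
move=> fE fF SA Ac oU Uc oV hV gU hK gK sh sg.
have [/(_ c Ac) isc _ _] := SA.
have [[od orng] [cr ir] [cK iK] [cc ic]] := isc.
have ok : open (cdom c `&` c @^-1` U) by exact: open_preimage_in.
set k := Chart _ _ _ _.
have isk : is_chart k.
  split => //=.
  - split; first by move=> a [_ Ua]; exact: hV.
    move=> y Vy; have Ug := gU y Vy; split; first exact/ir/Uc.
    by rewrite /preimage /= iK ?inE //; exact: Uc.
  - split; first by move=> a; rewrite inE => -[da Ua]; rewrite hK ?inE // cK ?inE.
    by move=> y; rewrite inE => Vy; rewrite iK ?inE ?gK ?inE //; exact/Uc/gU.
  - split.
      move=> a [da Ua]; apply: (@continuous_comp _ _ _ c h); first exact: cc.
      exact: (sh 0%N).
    move=> y Vy; apply: (@continuous_comp _ _ _ g (cinv c)); first exact: (sg 0%N).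
    by apply: ic; exact/Uc/gU.
split => // d Ad.
have [/(_ d Ad) isd _ _] := SA.
split => j.
  apply: (@class_C_comp _ _ _ _ j _ U (fun x => c (cinv d x)) h) => //.
  - exact: open_crng_preimage.
  - by move=> x [_ []].
  - by apply: class_C_subset (smooth_transition SA Ad Ac j) => x [? []].
apply: (@class_C_comp _ _ _ _ j _ _ g (fun x => d (cinv c x)))
  (smooth_transition SA Ac Ad j) => //.
- by apply: (open_crng_preimage isk); have [[]] := isd.
- by move=> y [Vy dy]; split => //; exact/Uc/gU.
- by apply: class_C_subset (sg j) => y [].
Qed.

Lemma continuous_prod_map (T1 T2 U1 U2 : topologicalType) (f : T1 -> U1)
    (g : T2 -> U2) a b : {for a, continuous f} -> {for b, continuous g} ->
  {for (a, b), continuous (fun p => (f p.1, g p.2))}.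
Proof.
move=> cf cg; apply: cvg_pair.
  by apply: (@continuous_comp _ _ _ fst f); [exact: cvg_fst|exact: cf].
by apply: (@continuous_comp _ _ _ snd g); [exact: cvg_snd|exact: cg].
Qed.

Lemma is_chart_prod (T T' : topologicalType) (E F : normedModType R)
    (k : chart T E) (l : chart T' F) : is_chart k -> is_chart l ->
  is_chart (prod_chart k l).
Proof.
case=> -[od orr] [s1 s2] [k1 k2] [c1 c2].
case=> -[od' orr'] [s1' s2'] [k1' k2'] [c1' c2'].
split => /=.
- by split; exact: open_prod.
- by split=> -[a b] [/= ? ?]; split; [exact: s1|exact: s1'|exact: s2|exact: s2'].
- split=> -[a b]; rewrite inE => -[/= ? ?].
    by rewrite k1 ?k1' ?inE.
  by rewrite k2 ?k2' ?inE.
- split=> -[a b] [/= ? ?].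
    by apply: continuous_prod_map; [exact: c1|exact: c1'].
  by apply: continuous_prod_map; [exact: c2|exact: c2'].
Qed.

Lemma smooth_prod (E E' F F' : normedModType R) (W : set E) (W' : set E')
    (f : E -> F) (g : E' -> F') : findim E -> findim E' -> open W -> open W' ->
  smooth W f -> smooth W' g ->
  smooth (W `*` W') (fun p => (f p.1, g p.2)).
Proof.
move=> fE fE' oW oW' sf sg k; have oWW := open_prod oW oW'.
apply: class_C_pair => //.
  apply: (@class_C_comp _ _ _ _ k _ W fst f) => //; first by move=> p [].
  exact: class_C_fst.
apply: (@class_C_comp _ _ _ _ k _ W' snd g) => //; first by move=> p [].
exact: class_C_snd.
Qed.

Lemma compatible_chart_prod (T T' : topologicalType) (E E' F F' : normedModType R)
    (A : set (chart T E)) (B : set (chart T' E')) (k : chart T F) (l : chart T' F') :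
  findim E -> findim E' -> findim F -> findim F' ->
  (forall c, A c -> is_chart c) -> (forall c, B c -> is_chart c) ->
  compatible_chart A k -> compatible_chart B l ->
  compatible_chart (prod_atlas A B) (prod_chart k l).
Proof.
move=> fE fE' fF fF' isA isB [isk ck] [isl cl].
split; first exact: is_chart_prod.
have dopen (T0 : topologicalType) (E0 : normedModType R) (c : chart T0 E0) :
    is_chart c -> open (cdom c) by case=> -[].
move=> _ [c Ac [d Bd] <-]; have [s1 s2] := ck c Ac; have [s1' s2'] := cl d Bd.
have isc := isA c Ac; have isd := isB d Bd.
split => j.
  have := @smooth_prod _ _ _ _ _ _ _ _ fE fE' _ _ s1 s1' j.
  move=> /(_ (open_crng_preimage isc (dopen _ _ _ isk))
             (open_crng_preimage isd (dopen _ _ _ isl))).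
  by apply: class_C_subset => p [[? ?] [? ?]].
have := @smooth_prod _ _ _ _ _ _ _ _ fF fF' _ _ s2 s2' j.
move=> /(_ (open_crng_preimage isk (dopen _ _ _ isc))
           (open_crng_preimage isl (dopen _ _ _ isd))).
by apply: class_C_subset => p [[? ?] [? ?]].
Qed.

(** In charts of the two atlases the map is a composite of two transition maps through the common
    model space [F]. *)
Lemma smooth_map_of_charts (T T' : topologicalType) (E E' F : normedModType R)
    (A : set (chart T E)) (B : set (chart T' E')) (k : chart T F) (l : chart T' F)
    (U : set T) : findim F ->
  (forall c, A c -> is_chart c) -> (forall c, B c -> is_chart c) ->
  compatible_chart A k -> compatible_chart B l ->
  open U -> U `<=` cdom k -> (forall a, U a -> crng l (k a)) ->
  smooth_map A B U (fun a => cinv l (k a)).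
Proof.
move=> fF isA isB [isk ck] [isl cl] oU Uk Ul.
have cf a : U a -> {for a, continuous (fun a => cinv l (k a))}.
  move=> Ua; apply: (@continuous_comp _ _ _ k (cinv l)).
    by have [_ _ _ [H _]] := isk; exact/H/Uk.
  by have [_ _ _ [_ H]] := isl; exact/H/Ul.
split => // c d Ac Bd j; have [s1 _] := ck c Ac; have [_ s2] := cl d Bd.
have [[od _] _ _ _] := isB d Bd.
apply: (@class_C_comp _ _ _ _ j _ _ (fun x => k (cinv c x))
  (fun y => d (cinv l y))) (s2 j) => //.
- have := open_crng_preimage (isA c Ac) (open_preimage_in oU cf od).
  congr (open _); apply/seteqP; split => x /=.
    by move=> [? [? ?]].
  by move=> [? ? ?].
- by move=> x [_ Ux dx]; split => //; exact: Ul.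
- by apply: class_C_subset (s1 j) => x [? Ux _]; split => //; exact: Uk.
Qed.

Lemma mul_nbhd (G : preTopGroupType) (W : set G) :
  {for ((1%g, 1%g) : G * G), continuous (fun p : G * G => (p.1 * p.2)%g)} ->
  open W -> W 1%g ->
  exists2 U : set G, open_nbhs 1%g U & forall a b, U a -> U b -> W (a * b)%g.
Proof.
move=> cm oW W1.
have : nbhs ((1%g, 1%g) : G * G) ((fun p : G * G => (p.1 * p.2)%g) @^-1` W).
  by apply: cm; apply: open_nbhs_nbhs; split => //=; rewrite mulg1.
move=> [[A B] [/= nA nB] AB].
exists (A° `&` B°).
  by split; [apply: openI; exact: open_interior|split].
by move=> a b [/interior_subset Aa _] [_ /interior_subset Bb]; exact: (AB (a, b)).
Qed.

(** The local isomorphism sends a point to the one with the same coordinates. The last hypothesis is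
    symmetric in the two groups, so it serves for the map and for its inverse. *)
Lemma locally_isomorphic_of_charts (G H : preTopGroupType) (E E' F : normedModType R)
    (A : set (chart G E)) (B : set (chart H E')) (k : chart G F) (l : chart H F) :
  findim F ->
  {for ((1%g, 1%g) : G * G), continuous (fun p : G * G => (p.1 * p.2)%g)} ->
  {for ((1%g, 1%g) : H * H), continuous (fun p : H * H => (p.1 * p.2)%g)} ->
  (forall c, A c -> is_chart c) -> (forall c, B c -> is_chart c) ->
  compatible_chart A k -> compatible_chart B l ->
  cdom k 1%g -> cdom l 1%g -> k 1%g = l 1%g ->
  (forall a b x y, cdom k a -> cdom k b -> cdom k (a * b)%g ->
    cdom l x -> cdom l y -> cdom l (x * y)%g ->
    k a = l x -> k b = l y -> k (a * b)%g = l (x * y)%g) ->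
  locally_isomorphic A B.
Proof.
move=> fF cG cH isA isB /[dup] ck [isk _] /[dup] cl [isl _] k1 l1 kl1 hom.
have [[odk ork] [kr kir] [kK kiK] [kc kic]] := isk.
have [[odl orl] [lr lir] [lK liK] [lc lic]] := isl.
have [U' [oU' U'1] UU] := mul_nbhd cG odk k1.
have [W' [oW' W'1] WW] := mul_nbhd cH odl l1.
pose f a := cinv l (k a); pose g x := cinv k (l x).
have of1 : open (cdom k `&` k @^-1` crng l) by exact: open_preimage_in.
have og1 : open (cdom l `&` l @^-1` crng k) by exact: open_preimage_in.
have cf a : cdom k a -> crng l (k a) -> {for a, continuous f}.
  by move=> ka la; apply: (@continuous_comp _ _ _ k (cinv l)); [exact: kc|exact: lic].
have cg a : cdom l a -> crng k (l a) -> {for a, continuous g}.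
  by move=> ka la; apply: (@continuous_comp _ _ _ l (cinv k)); [exact: lc|exact: kic].
(* The product of two points of [U] is only assumed to lie in [U]; requiring images in [W'] ensures
   that the product of the images lies in the domain of [l], where [l] is injective. *)
pose U := (cdom k `&` k @^-1` crng l) `&` (U' `&` f @^-1` W').
pose V := (cdom l `&` l @^-1` crng k) `&` (W' `&` g @^-1` U').
have oU : open U.
  rewrite /U [U' `&` _]setIC setIA; apply: openI => //.
  by apply: open_preimage_in => // a [? ?]; exact: cf.
have oV : open V.
  rewrite /V [W' `&` _]setIC setIA; apply: openI => //.
  by apply: open_preimage_in => // a [? ?]; exact: cg.
have fK a : U a -> [/\ cdom k a, cdom l (f a), l (f a) = k a & g (f a) = a].
  move=> [[ka la] _].
  have lf : l (f a) = k a by rewrite /f liK ?inE.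
  by split => //; [exact: lir|rewrite /g lf kK ?inE].
have gK x : V x -> [/\ cdom l x, cdom k (g x), k (g x) = l x & f (g x) = x].
  move=> [[ka la] _].
  have lf : k (g x) = l x by rewrite /g kiK ?inE.
  by split => //; [exact: kir|rewrite /f lf lK ?inE].
have fV : set_fun U V f.
  move=> a Ua; have [ka lfa e1 e2] := fK a Ua; have [[_ la] [U'a W'f]] := Ua.
  split; split => //; rewrite /preimage /= ?e1 ?e2 //; exact: kr.
have gU : set_fun V U g.
  move=> a Ua; have [ka lfa e1 e2] := gK a Ua; have [[_ la] [U'a W'f]] := Ua.
  split; split => //; rewrite /preimage /= ?e1 ?e2 //; exact: lr.
have f1 : f 1%g = 1%g by rewrite /f kl1 lK ?inE.
have g1 : g 1%g = 1%g by rewrite /g -kl1 kK ?inE.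
exists U, V, f, g; split.
- split; split => //; split; split; rewrite /preimage /= ?f1 ?g1 //.
    by rewrite kl1; exact: lr.
  by rewrite -kl1; exact: kr.
- by [].
- by split=> a; rewrite inE; [case/fK|case/gK].
- split; apply: smooth_map_of_charts => //.
  + by move=> a [[]].
  + by move=> a [[]].
  + by move=> a [[]].
  + by move=> a [[]].
- split=> [a b Ua Ub Uab|x y Vx Vy Vxy].
    have [ka la ea _] := fK a Ua; have [kb lb eb _] := fK b Ub.
    have [kab _ eab _] := fK _ Uab.
    have lab : cdom l (f a * f b)%g.
      by apply: WW; [have [_ []] := Ua|have [_ []] := Ub].
    apply: (can_in_inj lK); rewrite ?inE //; first by have [] := fK _ Uab.
    by rewrite eab; exact: hom.
  have [lx kx ex _] := gK x Vx; have [ly ky ey _] := gK y Vy.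
  have [lxy _ exy _] := gK _ Vxy.
  have kab : cdom k (g x * g y)%g.
    by apply: UU; [have [_ []] := Vx|have [_ []] := Vy].
  apply: (can_in_inj kK); rewrite ?inE //; first by have [] := gK _ Vxy.
  by rewrite exy; apply/esym; exact: hom.
Qed.

End CompatibleCharts.

(** * The chart of the universal cover of SL(2, R) *)

Section UniversalCover.
Context {R : realType}.

Lemma det2E (M : 'M[R]_2) : \det M = M 0 0 * M 1 1 - M 0 1 * M 1 0.
Proof.
rewrite (expand_det_row _ 0) sum2 /cofactor !det_mx11 !mxE /=.
have -> : lift 0 0 = 1 :> 'I_2 by apply/val_inj.
have -> : lift 1 0 = 0 :> 'I_2 by apply/val_inj.
by rewrite expr0 expr1; ring.
Qed.

Lemma derive_det2 (E : normedModType R) (f : E -> 'M[R]_2) x v :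
  differentiable f x -> f x = 1 ->
  'D_v (fun y => \det (f y) : R^o) x = \tr ('D_v f x).
Proof.
move=> df fx.
have dc a b : derivable (fun y => f y a b : R^o) x v.
  apply: diff_derivable.
  exact: (@differentiable_comp _ _ _ _ f (fun M : 'M[R]_2 => M a b : R^o) x df
    (differentiable_coord _ _ _)).
have D a b : is_derive x v (fun y => f y a b : R^o) (('D_v f x) a b).
  by rewrite derive_coord_mx //; exact: derivableP.
have H a b a' b' : is_derive x v
    ((fun y => f y a b : R^o) * (fun y => f y a' b' : R^o))
    (f x a b *: ('D_v f x) a' b' + f x a' b' *: ('D_v f x) a b).
  exact: is_deriveM.
have -> : (fun y => \det (f y) : R^o) =
    (fun y => f y 0 0 : R^o) * (fun y => f y 1 1 : R^o) -
    (fun y => f y 0 1 : R^o) * (fun y => f y 1 0 : R^o).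
  by apply/funext => y; rewrite det2E.
have [_ ->] := is_deriveB (H 0 0 1 1) (H 0 1 1 0).
by rewrite fx !mxE /= tr2E /GRing.scale /=; ring.
Qed.

Lemma open_neq0_in (E : normedModType R) (W : set E) (g : E -> R^o) :
  open W -> class_C 0 W g -> open (W `&` [set x | g x != 0]).
Proof.
by move=> oW cg; apply: (@open_preimage_in _ _ W g [set y | y != 0]).
Qed.

Lemma universal_cover_chart (S : preTopGroupType) (A : set (chart S 'rV[R]_3)) :
  is_universal_cover_SL2 A ->
  exists (p : S -> 'M[R]_2) (k : chart S 'rV[R]_3),
    [/\ forall x y, p (x * y)%g = p x * p y, compatible_chart A k,
        cdom k 1%g, k 1%g = proj_coord 1 &
        forall s, cdom k s -> k s = proj_coord (p s) /\ p s 0 0 != 0].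
Proof.
move=> [LG _ [p [pM [_ rp _] sp]]].
have [_ _ SA _ _] := LG; have [_ atl _] := SA.
have [c Ac c1] := atl 1%g.
have detp s : \det (p s) = 1 by have : range p (p s) by []; rewrite rp.
(* An invertible idempotent is the identity. *)
have p1 : p 1%g = 1.
  have u : p 1%g \in unitmx by rewrite unitmxE detp unitr1.
  have := pM 1%g 1%g; rewrite mulg1 => e.
  by have := congr1 (mulmx (invmx (p 1%g))) e; rewrite mulKmx // mulVmx.
have [sf immf] := sp c Ac.
pose f x := p (cinv c x); pose x0 := c 1%g.
have orng := open_crng LG Ac; have cx0 := crng_chart1 LG Ac c1.
have f1 : f x0 = 1 by rewrite /f (cinv_chart1 LG Ac c1).
pose W := crng c `&` [set x | f x 0 0 != 0].
have oW : open W.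
  exact: (open_neq0_in orng (class_C_coord 0 0 orng (sf 0%N))).
have Wx0 : W x0 by split => //; rewrite /= f1 mxE /= oner_neq0.
have sfW : smooth W f by move=> k; apply: class_C_subset (sf k) => x [].
have sh : smooth W (proj_coord \o f).
  by move=> k; apply: class_C_proj_coord => // x [].
have df x : W x -> differentiable f x by have [+ _] := sfW 1; exact.
have [||U [V [g [[oU oV] [Ux0 UW] [hV gU] [hK gK] sg]]]] :=
  @inverse_function _ _ (proj_coord \o f) W x0 oW Wx0.
- exact: sh.
- move=> v Dv0.
  have dq : differentiable (proj_coord \o f) x0 by have [+ _] := sh 1; apply.
  have e := derive_proj_coord (df _ Wx0) f1 dq Dv0.
  (* The determinant is constantly 1, so the derivative at the identity is traceless; being also
     scalar it vanishes, which contradicts the immersion property unless v = 0. *)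
  have tr0 : \tr ('D_v f x0) = 0.
    rewrite -(derive_det2 _ (df _ Wx0) f1).
    have -> : (fun y => \det (f y) : R^o) = fun=> 1.
      by apply/funext => y; exact: detp.
    exact: derive_cst.
  have D0 : 'D_v f x0 = 0.
    move: tr0; rewrite e mxtrace_scalar => /eqP.
    by rewrite mulrn_eq0 /= => /eqP ->; rewrite raddf0.
  apply/eqP/negPn/negP => v0.
  by have := immf x0 v cx0 v0; rewrite -/f D0 eqxx.
have cK := @compatible_chart_of_inverse _ _ _ _ A c U V _ g
  (findim_mx 1 3) (findim_mx 1 3) SA Ac oU _ oV hV gU hK gK.
exists p, (Chart (cdom c `&` c @^-1` U) V
  (fun a => (proj_coord \o f) (c a)) (fun y => cinv c (g y))).
split => //=.
- apply: cK => //; first by move=> x /UW[].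
  by move=> k; exact: class_C_subset (sh k).
- by rewrite -/x0 f1.
- by move=> s [cs /UW[_ /=]]; rewrite /f (chartK LG Ac).
Qed.

End UniversalCover.

(** * The chart of a group with Lie algebra sl(2) x sl(2) *)

Lemma unit_mul2 (R : realType) (X Y : 'M[R]_2) :
  \det X != 0 -> \det Y != 0 -> X * Y \is a GRing.unit.
Proof.
move=> dX dY; have : X *m Y \in unitmx.
  by rewrite unitmxE det_mulmx unitfE mulf_neq0.
exact.
Qed.

Section Sl2Sl2Chart.
Context {R : realType} {G : preTopGroupType}.
Local Notation E := 'rV[R]_6.
Variables (A : set (chart G E)) (c : chart G E).
Hypotheses (LG : lie_group A) (Ac : A c) (c1 : cdom c 1%g).
Local Notation ci := (cinv c).
Local Notation x0 := (c 1%g).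
Local Notation br := (fun u v => v *m ad c u).
Variable T : bool -> E -> 'M[R]_2.
Hypotheses (Tlin : forall i, linear (T i))
  (Tbr : forall i u v, T i (br u v) = T i u * T i v - T i v * T i u)
  (Ttr : forall i v, \tr (T i v) = 0)
  (Tinj : forall v, (forall i, T i v = 0) -> v = 0)
  (Tsurj : forall M : bool -> 'M[R]_2, (forall i, \tr (M i) = 0) ->
    exists v, forall i, T i v = M i).
Variables hv ev fv : bool -> E.
Hypothesis vP : forall i j,
  [/\ T i (hv j) = (i == j)%:R *: (delta_mx 0 0 - delta_mx 1 1),
      T i (ev j) = (i == j)%:R *: delta_mx 0 1 &
      T i (fv j) = (i == j)%:R *: delta_mx 1 0].

Definition adjoint_intertwiner i (a : G) : 'M[R]_2 :=
  intertwiner (T i (ev i *m adjoint c a)) (T i (fv i *m adjoint c a)).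
Local Notation P := adjoint_intertwiner.

Let Tcont i : continuous (linear_of (Tlin i)).
Proof. exact: findim_linear_continuous (findim_mx _ _). Qed.

Let oI := open_inv_dom LG Ac.

Lemma smooth_T_adjoint i (w : E) :
  smooth (inv_dom c) (fun x => T i (w *m adjoint c (ci x))).
Proof.
move=> k; apply: (class_C_comp_linear (l := linear_of (Tlin i)) oI (@Tcont i)).
apply: class_C_mulmx => //; first exact: class_C_cst.
exact: (smooth_adjoint LG Ac c1).
Qed.

Lemma smooth_adjoint_intertwiner i :
  smooth (inv_dom c) (fun x => P i (ci x)).
Proof.
move=> k.
have C (a b : 'I_2) : class_C k (inv_dom c) (fun=> delta_mx a b : 'M[R]_2).
  exact: class_C_cst.
have Ce := smooth_T_adjoint i (ev i) k; have Cf := smooth_T_adjoint i (fv i) k.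
apply: class_CD => //.
  exact: (class_C_mulmx oI (class_C_mulmx oI Ce Cf) (C 0 0)).
exact: (class_C_mulmx oI Cf (C 0 1)).
Qed.

Lemma adjoint_intertwiner1 i : P i 1%g = 1.
Proof.
have [_ eE fE] := vP i i; rewrite eqxx scale1r in eE; rewrite eqxx scale1r in fE.
rewrite /P (adjoint1 LG Ac c1) !mulmx1 eE fE /intertwiner.
by apply: mx2P; rewrite mxE !mul2E !mxE /= ?mulr0n ?mulr1n; ring.
Qed.

(** Three open conditions that hold at the identity: the first prevents Ad from exchanging the
    factors, the second makes the projective coordinates meaningful, and the third makes the
    intertwiner invertible, as its uniqueness requires. *)
Definition good_dom : set E := [set x | inv_dom c x /\
  forall i, [/\ T i (ev i *m adjoint c (ci x)) 0 1 != 0, P i (ci x) 0 0 != 0 &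
    \det (P i (ci x)) != 0]].

Lemma open_good_dom : open good_dom.
Proof.
have o1 i := open_neq0_in oI (class_C_coord 0 1 oI (smooth_T_adjoint i (ev i) 0%N)).
have o2 i := open_neq0_in oI (class_C_coord 0 0 oI (smooth_adjoint_intertwiner i 0%N)).
have o3 i := open_neq0_in oI (class_C_det oI (smooth_adjoint_intertwiner i 0%N)).
have oi i := openI (openI (o1 i) (o2 i)) (o3 i).
have := openI (oi false) (oi true); congr (open _).
apply/seteqP; split => x /=.
  by move=> [[[[ix ?] [_ ?]] [_ ?]] [[[_ ?] [_ ?]] [_ ?]]]; split => // -[].
by move=> [ix H]; have [? ? ?] := H false; have [? ? ?] := H true.
Qed.

Lemma good_dom1 : good_dom x0.
Proof.
split; first exact: (inv_dom1 LG Ac c1).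
move=> i; rewrite (cinv_chart1 LG Ac c1) adjoint_intertwiner1 det1 mxE.
rewrite (adjoint1 LG Ac c1) mulmx1; have [_ -> _] := vP i i.
by rewrite eqxx scale1r mxE /= !oner_neq0.
Qed.

Lemma intertwiner_adjoint i a v : sym_dom c a ->
  (forall i, T i (ev i *m adjoint c a) 0 1 != 0) ->
  T i (v *m adjoint c a) * P i a = P i a * T i v.
Proof.
move=> sa e0.
have philin : linear (fun v : E => v *m adjoint c a : E).
  by move=> k u w; rewrite /= mulmxDl scalemxAl.
apply: (automorphism_intertwiner Tlin Tbr Ttr Tinj vP philin) => [u w|j].
  by rewrite -!mulmxA (adjoint_ad LG Ac c1).
by apply/eqP => /matrixP/(_ 0 1) /eqP; rewrite [X in _ == X]mxE; apply/negP/e0.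
Qed.

(** Differentiating Ad(x)(w) P = P w at the identity along [v], where P = 1, the scalar derivative
    of P contributes equally to both sides. What remains is [v, w] = 0 in each factor, so [v] is
    central. *)
Lemma derive_adjoint_intertwiner v :
  (forall i, exists a, 'D_v (fun x => P i (ci x)) x0 = a%:M) -> v = 0.
Proof.
move=> DP; apply: (sl2sl2_center Tbr Ttr Tinj Tsurj) => i w.
have [a Da] := DP i.
have dP : differentiable (fun x => P i (ci x)) x0.
  by have [+ _] := smooth_adjoint_intertwiner i 1; apply; exact: (inv_dom1 LG Ac c1).
have dT : differentiable (fun x => T i (w *m adjoint c (ci x))) x0.
  by have [+ _] := smooth_T_adjoint i w 1; apply; exact: (inv_dom1 LG Ac c1).
have : 'D_v (fun x => T i (w *m adjoint c (ci x)) *m P i (ci x)) x0 =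
       'D_v (fun x => P i (ci x) *m T i w) x0.
  apply: near_eq_derive.
  have nG : nbhs x0 good_dom.
    by apply: open_nbhs_nbhs; split; [exact: open_good_dom|exact: good_dom1].
  apply: filterS nG => x [ix H]; apply: intertwiner_adjoint.
    exact: (sym_dom_cinv LG Ac ix).
  by move=> j; have [] := H j.
rewrite (derive_mulmx v dT dP) (derive_mulmxr (T i w) v dP).
rewrite (cinv_chart1 LG Ac c1) adjoint_intertwiner1 mulmx1 (adjoint1 LG Ac c1) mulmx1 Da.
rewrite mul_mx_scalar mul_scalar_mx => /(canRL (addrK _)); rewrite subrr => DT0.
have dA := differentiable_adjoint LG Ac c1.
have dwA : differentiable (fun x => w *m adjoint c (ci x)) x0.
  have lw : linear (mulmx w : 'M[R]_6 -> 'rV[R]_6) by exact: linearP.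
  apply: (@differentiable_comp _ _ _ _ (fun x => adjoint c (ci x)) (linear_of lw)) => //.
  apply: linear_differentiable; exact: findim_linear_continuous (findim_mx _ _).
have := derive_comp_linear v (@Tcont i) dwA.
rewrite (derive_mulmxl w v dA) => H.
by apply: etrans (esym H) _; exact: DT0.
Qed.

(** The product of the intertwiners of [a] and [b] is an invertible intertwiner for [a * b], so
    uniqueness up to a scalar applies. The scalar is nonzero because the entry (0, 0) of P(ab)
    is. *)
Lemma adjoint_intertwinerM i a b : sym_dom c a -> sym_dom c b ->
  sym_dom c (a * b)%g -> good_dom (c a) -> good_dom (c b) -> good_dom (c (a * b)%g) ->
  exists2 l, l != 0 & P i (a * b)%g = l *: (P i a * P i b).
Proof.
move=> /[dup] sa [ca _] /[dup] sb [cb _] /[dup] sab [cab _] [_].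
rewrite (chartK LG Ac ca) => Ha [_]; rewrite (chartK LG Ac cb) => Hb [_].
rewrite (chartK LG Ac cab) => Hab.
have [_ _ da] := Ha i; have [_ _ db] := Hb i; have [_ p0 _] := Hab i.
have [|v|v|l e] := @intertwiner_unique _ _ T Tsurj i
  (fun v => T i (v *m adjoint c (a * b)%g)) (P i a * P i b) (P i (a * b)%g).
- exact: unit_mul2.
- rewrite (adjointM LG Ac c1 sa sb) mulmxA mulrA.
  rewrite (intertwiner_adjoint i _ sa); last by move=> j; have [] := Ha j.
  rewrite -mulrA (intertwiner_adjoint i _ sb) ?mulrA //.
  by move=> j; have [] := Hb j.
- by apply: (intertwiner_adjoint i _ sab) => j; have [] := Hab j.
exists l => //; apply/eqP => l0; move: p0.
by rewrite e l0 scale0r mxE eqxx.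
Qed.

Definition adjoint_coord (x : E) : E :=
  row_mx (proj_coord (P false (ci x))) (proj_coord (P true (ci x))).

(** Concatenation becomes a sum of products with constant matrices, to which the closure properties
    of [class_C] apply. *)
Lemma row_mx_mul m n1 n2 (a : 'M[R]_(m, n1)) (b : 'M[R]_(m, n2)) :
  row_mx a b = a *m row_mx 1%:M 0 + b *m row_mx 0 1%:M.
Proof. by rewrite !mul_mx_row add_row_mx !mulmx1 !mulmx0 addr0 add0r. Qed.

Lemma smooth_proj_intertwiner i :
  smooth good_dom (fun x => proj_coord (P i (ci x))).
Proof.
move=> k; apply: (class_C_proj_coord open_good_dom).
  by move=> x [_ H]; have [] := H i.
by apply: class_C_subset (smooth_adjoint_intertwiner i k) => x [].
Qed.

Lemma smooth_adjoint_coord : smooth good_dom adjoint_coord.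
Proof.
move=> k; have oG := open_good_dom.
have C m n (B : 'M[R]_(m, n)) : class_C k good_dom (fun=> B) by exact: class_C_cst.
have := class_CD oG
  (class_C_mulmx oG (smooth_proj_intertwiner false k) (C 3%N (3 + 3)%N (row_mx 1%:M 0)))
  (class_C_mulmx oG (smooth_proj_intertwiner true k) (C 3%N (3 + 3)%N (row_mx 0 1%:M))).
apply: eq_class_C => // x _; exact: esym (row_mx_mul _ _).
Qed.

Lemma derive_adjoint_coord v : 'D_v adjoint_coord x0 = 0 -> v = 0.
Proof.
move=> D0; apply: derive_adjoint_intertwiner => i.
have dH : differentiable adjoint_coord x0.
  by have [+ _] := smooth_adjoint_coord 1; apply; exact: good_dom1.
pose B : 'M[R]_(3 + 3, 3) := if i then col_mx 0 1%:M else col_mx 1%:M 0.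
have eB : (fun x => proj_coord (P i (ci x))) = (fun x => adjoint_coord x *m B).
  apply/funext => x; rewrite /B /adjoint_coord; case: (i).
    by rewrite (@mul_row_col _ 1 3 3 3) mulmx0 mulmx1 add0r.
  by rewrite (@mul_row_col _ 1 3 3 3) mulmx0 mulmx1 addr0.
have dP : differentiable (fun x => P i (ci x)) x0.
  by have [+ _] := smooth_adjoint_intertwiner i 1; apply; exact: (inv_dom1 LG Ac c1).
have dq : differentiable (fun x => proj_coord (P i (ci x))) x0.
  by have [+ _] := smooth_proj_intertwiner i 1; apply; exact: good_dom1.
have f1 : P i (ci x0) = 1 by rewrite (cinv_chart1 LG Ac c1) adjoint_intertwiner1.
exists (('D_v (fun x => P i (ci x)) x0) 0 0).
apply: (derive_proj_coord dP f1 dq).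
rewrite -[_ \o _]/(fun x => proj_coord (P i (ci x))) eB.
by rewrite (derive_mulmxr B v dH) D0 mul0mx.
Qed.

Lemma sl2sl2_chart : exists k : chart G ('rV[R]_3 * 'rV[R]_3)%type,
  [/\ compatible_chart A k, cdom k 1%g, k 1%g = (proj_coord 1, proj_coord 1),
    forall a, cdom k a -> k a = (proj_coord (P false a), proj_coord (P true a)) /\
      forall i, P i a 0 0 != 0 &
    forall a b i, cdom k a -> cdom k b -> cdom k (a * b)%g ->
      exists2 l, l != 0 & P i (a * b)%g = l *: (P i a * P i b)].
Proof.
have [U [V [g [[oU oV] [Ux0 UW] [hV gU] [hK gK] sg]]]] :=
  inverse_function open_good_dom good_dom1 smooth_adjoint_coord derive_adjoint_coord.
have [_ _ SA _ _] := LG.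
(* The inverse function theorem needs equal row spaces, while the comparison needs pairs to match a
   product chart; [j] and [l] identify the two. *)
pose j (z : 'rV[R]_3 * 'rV[R]_3) : E := row_mx z.1 z.2.
pose l (y : E) : 'rV[R]_3 * 'rV[R]_3 := (@lsubmx _ 1 3 3 y, @rsubmx _ 1 3 3 y).
have fF : findim ('rV[R]_3 * 'rV[R]_3)%type by apply: findim_prod; exact: findim_mx.
have lj : linear j.
  move=> a z w; have e : row_mx (a *: z.1 + w.1) (a *: z.2 + w.2) =
      a *: row_mx z.1 z.2 + row_mx w.1 w.2 :> 'rV[R]_(3 + 3).
    by rewrite scale_row_mx add_row_mx.
  exact: e.
have ll : linear l by move=> a z w; rewrite /l !linearP.
have cj : continuous j by exact: (@findim_linear_continuous _ _ _ (linear_of lj)).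
have cl : continuous l.
  by apply: (@findim_linear_continuous _ _ _ (linear_of ll)); exact: findim_mx.
have jl y : j (l y) = y by rewrite /j /l /= hsubmxK.
have lK z : l (j z) = z by case: z => z w; rewrite /j /l row_mxKl row_mxKr.
have oV' : open (j @^-1` V) by apply: open_comp => // ? _; exact: cj.
have Ucr x : U x -> crng c x by move=> /UW[[]].
have cK := @compatible_chart_of_inverse _ _ _ _ A c U (j @^-1` V) (l \o adjoint_coord)
  (g \o j) (findim_mx _ _) fF SA Ac oU Ucr oV'.
exists (Chart (cdom c `&` c @^-1` U) (j @^-1` V)
  (fun a => (l \o adjoint_coord) (c a)) (fun y => cinv c ((g \o j) y))).
have kE a : cdom c a -> (l \o adjoint_coord) (c a) =
    (proj_coord (P false a), proj_coord (P true a)).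
  by move=> ca; rewrite /= /adjoint_coord (chartK LG Ac ca) /l row_mxKl row_mxKr.
have sym a : cdom c a -> U (c a) -> sym_dom c a.
  by move=> ca /UW[ix _]; have := sym_dom_cinv LG Ac ix; rewrite (chartK LG Ac ca).
split => //=.
- apply: cK.
  + by move=> x Ux; rewrite /preimage /= jl; exact: hV.
  + by move=> z Vz; exact: gU.
  + by move=> x Ux; rewrite /= jl hK.
  + by move=> z; rewrite inE => Vz; rewrite /= gK ?inE // lK.
  + move=> k; apply: (class_C_comp_linear (l := linear_of ll) oU cl).
    exact: class_C_subset (smooth_adjoint_coord k).
  + move=> k; apply: (@class_C_comp _ _ _ _ k _ V j g) => //; first exact: findim_mx.
    exact: (@class_C_linear _ _ _ k _ (linear_of lj)).
- by have := kE _ c1; rewrite /= => ->; rewrite !adjoint_intertwiner1.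
- move=> a [ca Ua]; split; first exact: kE.
  by move=> i; have [_ H] := UW _ Ua; have [_] := H i; rewrite (chartK LG Ac ca).
- move=> a b i [ca Ua] [cb Ub] [cab Uab].
  by apply: adjoint_intertwinerM; [exact: sym|exact: sym|exact: sym| | |]; exact: UW.
Qed.

End Sl2Sl2Chart.

(** * The Lie algebra of the structure equations *)

(** A linear relation between the basis forms at the identity propagates to all points by left
    invariance. It then represents the zero form, whose coordinates are unique, so the relation is
    trivial. *)
Lemma coframe_unit (R : realType) n (G : preTopGroupType)
    (A : set (chart G 'rV[R]_n)) c (e : n.-tuple (form1 G 'rV[R]_n)) :
  lie_group A -> A c -> cdom c 1%g -> left_invariant_basis A e ->
  (\matrix_(i, j) tnth e j c (c 1%g) (delta_mx 0 i) : 'M[R]_n) \in unitmx.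
Proof.
move=> LG Ac c1 [le basis]; set O := \matrix_(_, _) _.
have cx0 := crng_chart1 LG Ac c1.
rewrite -unitmx_tr; apply: unitmx_of_injective => k kO.
have Ok : O *m k^T = 0 by apply: trmx_inj; rewrite trmx_mul trmxK kO trmx0.
have k0 (v : 'rV[R]_n) : \sum_(i < n) k 0 i * tnth e i c (c 1%g) v = 0.
  transitivity ((v *m (O *m k^T)) 0 0); last by rewrite Ok mulmx0 mxE.
  rewrite mulmxA mxE; apply: eq_bigr => i _; rewrite mulrC [k^T _ _]mxE; congr (_ * _).
  have [fe _] := le i; rewrite (form_colE Ac v fe cx0) !mxE.
  by apply: eq_bigr => j _; rewrite !mxE.
have ke d x v : A d -> crng d x -> \sum_(i < n) k 0 i * tnth e i d x v = 0.
  move=> Ad dx; have [dd [cr ir] _ _] : is_chart d by have [_ _ [H _ _] _ _] := LG; exact: H.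
  (* Left translation by [g] brings the point back to the identity. *)
  pose g := (cinv d x)^-1%g.
  have gx : (g * cinv d x)%g = 1%g by rewrite mulVg.
  rewrite -[RHS](k0 ('D_v (fun y => c (g * cinv d y)%g) x)).
  apply: eq_bigr => i _; congr (_ * _).
  have [_ /(_ g d c x v Ad Ac dx)] := le i; rewrite gx => /(_ c1) <-.
  by [].
pose w0 : form1 G 'rV[R]_n := fun _ _ _ => 0.
have lw0 : left_invariant A w0.
  split; last by move=> g d d' x v.
  split => //.
    by move=> d x _ _ a u v; rewrite /w0 scaler0 addr0.
  by move=> d v _ j; exact: class_C_cst.
have [k' [_ uk]] := basis w0 lw0.
have <- : k' = k by apply: uk => d x v Ad dx; rewrite ke.
apply: uk => d x v Ad dx; rewrite /w0 big1 // => i _.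
by rewrite mxE mul0r.
Qed.

Section Sl2Coordinates.
Context {R : realType}.
Variables (a3 a4 rho : R).
Hypotheses (rho0 : 0 < rho) (rho2 : rho ^+ 2 = a3 ^+ 2 + a4 ^+ 2).

Local Notation idx k := (inord k : 'I_6).

(* Coordinates 0, ..., 5 refer to e1, e2, e3, e4, e5, A2.  In complex notation
   z = e1 + i e2 and w = (a3 + i a4) (e3 - i e4) / rho, the forms z + s i w and
   A2 + s rho e5, for a sign s, span a closed system isomorphic to the dual of
   sl(2, R). *)
Definition sl2_coord (b : bool) (y : 'rV[R]_6) : 'M[R]_2 :=
  let s : R := if b then -1 else 1 in
  let X := rho * y 0 (idx 0) - s * (a4 * y 0 (idx 2) - a3 * y 0 (idx 3)) in
  let Y := rho * y 0 (idx 1) + s * (a3 * y 0 (idx 2) + a4 * y 0 (idx 3)) in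
  let Z := y 0 (idx 5) + s * rho * y 0 (idx 4) in
  \matrix_(i, j) (2^-1 * (if i == 0 then if j == 0 then X - Y else X + Y - Z
                          else if j == 0 then X + Y + Z else Y - X)).

Lemma sl2_coord_linear b : linear (sl2_coord b).
Proof.
move=> a u v; apply: mx2P; rewrite /sl2_coord !mxE /=; ring.
Qed.

Lemma tr_sl2_coord b y : \tr (sl2_coord b y) = 0.
Proof. by rewrite tr2E !mxE /=; ring. Qed.

(** The hypotheses are the structure equations for a1 = a2 = 0 with dw(x, y) = - w(z), where z
    stands for the bracket of x and y. *)
Lemma sl2_coord_bracket b (x y z : 'rV[R]_6) :
  let W i j := x 0 (idx i) * y 0 (idx j) - y 0 (idx i) * x 0 (idx j) in
  z 0 (idx 0) = - (W 5 1 - a3 * W 2 4 - a4 * W 3 4) ->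
  z 0 (idx 1) = - (- W 5 0 + a3 * W 3 4 - a4 * W 2 4) ->
  z 0 (idx 2) = - (- W 5 3 + a3 * W 0 4 + a4 * W 1 4) ->
  z 0 (idx 3) = - (W 5 2 - a3 * W 1 4 + a4 * W 0 4) ->
  z 0 (idx 4) = - (2 * a3 * (W 0 2 - W 1 3) + 2 * a4 * (W 0 3 + W 1 2)) ->
  z 0 (idx 5) = - (2 * (a3 ^+ 2 + a4 ^+ 2) * (W 0 1 - W 2 3)) ->
  sl2_coord b z = sl2_coord b x * sl2_coord b y - sl2_coord b y * sl2_coord b x.
Proof.
move=> W z0 z1 z2 z3 z4 z5.
(* The proof is linear once monomials are taken as atoms, so [rho2] is supplied multiplied by the
   three products where it is needed: W 0 1 for the last equation, W 0 4 and W 1 4 for the third and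
   fourth. *)
have r1 := congr1 (fun t => t * W 0%N 1%N) rho2.
have r2 := congr1 (fun t => t * W 0%N 4%N) rho2.
have r3 := congr1 (fun t => t * W 1%N 4%N) rho2.
rewrite /W in z0 z1 z2 z3 z4 z5 r1 r2 r3.
have sub2 (B C : 'M[R]_2) i j : (B - C) i j = B i j - C i j by rewrite !mxE.
case: b; apply: mx2P; rewrite sub2 !mul2E !mxE /= ?z0 ?z1 ?z2 ?z3 ?z4 ?z5;
  clear z0 z1 z2 z3 z4 z5;
  move: r1 r2 r3; move: (x 0 _) (x 0 _) (x 0 _) (x 0 _) (x 0 _) (x 0 _)
    (y 0 _) (y 0 _) (y 0 _) (y 0 _) (y 0 _) (y 0 _) => *; lra.
Qed.

Lemma sl2_coord_inj y : (forall b, sl2_coord b y = 0) -> y = 0.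
Proof.
move=> H; have /matrixP T := H true; have /matrixP F := H false.
have T00 := T 0 0; have T01 := T 0 1; have T10 := T 1 0.
have F00 := F 0 0; have F01 := F 0 1; have F10 := F 1 0.
rewrite !mxE /= in T00 T01 T10 F00 F01 F10.
have rn0 : rho != 0 by rewrite gt_eqF.
have y0 : y 0 (idx 0) = 0 by apply: (mulfI rn0); lra.
have y1 : y 0 (idx 1) = 0 by apply: (mulfI rn0); lra.
have y4 : y 0 (idx 4) = 0 by apply: (mulfI rn0); lra.
have y5 : y 0 (idx 5) = 0 by lra.
(* The coordinates 2 and 3 enter through a 2x2 system of determinant rho^2, which is inverted
   below. *)
have e1 : a4 * y 0 (idx 2) - a3 * y 0 (idx 3) = 0 by lra.
have e2 : a3 * y 0 (idx 2) + a4 * y 0 (idx 3) = 0 by lra.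
have rn2 : rho ^+ 2 != 0 by rewrite expf_neq0.
have y2 : y 0 (idx 2) = 0.
  apply: (mulfI rn2); rewrite rho2 mulr0.
  transitivity (a3 * (a3 * y 0 (idx 2) + a4 * y 0 (idx 3)) +
                a4 * (a4 * y 0 (idx 2) - a3 * y 0 (idx 3))); first by ring.
  by rewrite e1 e2; ring.
have y3 : y 0 (idx 3) = 0.
  apply: (mulfI rn2); rewrite rho2 mulr0.
  transitivity (a4 * (a3 * y 0 (idx 2) + a4 * y 0 (idx 3)) -
                a3 * (a4 * y 0 (idx 2) - a3 * y 0 (idx 3))); first by ring.
  by rewrite e1 e2; ring.
apply/rowP => k; rewrite mxE -(inord_val k).
by case: k => -[|[|[|[|[|[|//]]]]]].
Qed.

Lemma sl2_coord_surj (M : bool -> 'M[R]_2) : (forall b, \tr (M b) = 0) ->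
  exists y, forall b, sl2_coord b y = M b.
Proof.
move=> tM; have rn0 : rho != 0 by rewrite gt_eqF.
have tT := tM true; have tF := tM false; rewrite !tr2E in tT tF.
(* [X], [Y], [Z] recover the quantities of the same names in [sl2_coord] from the matrix entries.
   Half sums over the two signs then isolate the coordinates 0, 1, 5, and half differences the
   coordinates 2, 3, 4. *)
pose X b := M b 0 0 + (M b 0 1 + M b 1 0) / 2.
pose Y b := (M b 0 1 + M b 1 0) / 2 - M b 0 0.
pose Z b := M b 1 0 - M b 0 1.
pose s := (X true - X false) / 2.
pose t := (Y false - Y true) / 2.
pose r := [:: (X true + X false) / 2 / rho; (Y true + Y false) / 2 / rho;
  (a4 * s + a3 * t) / rho ^+ 2; (- a3 * s + a4 * t) / rho ^+ 2;
  (Z false - Z true) / 2 / rho; (Z true + Z false) / 2].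
pose y : 'rV[R]_6 := \row_j nth 0 r j.
have y0 : rho * y 0 (idx 0) = (X true + X false) / 2.
  by rewrite mxE inordK //= mulrC divfK.
have y1 : rho * y 0 (idx 1) = (Y true + Y false) / 2.
  by rewrite mxE inordK //= mulrC divfK.
have y4 : rho * y 0 (idx 4) = (Z false - Z true) / 2.
  by rewrite mxE inordK //= mulrC divfK.
have y5 : y 0 (idx 5) = (Z true + Z false) / 2 by rewrite mxE inordK.
have y2 : y 0 (idx 2) = (a4 * s + a3 * t) / rho ^+ 2 by rewrite mxE inordK.
have y3 : y 0 (idx 3) = (- a3 * s + a4 * t) / rho ^+ 2 by rewrite mxE inordK.
have n2 : a3 ^+ 2 + a4 ^+ 2 != 0 by rewrite -rho2 expf_neq0.
have es : a4 * y 0 (idx 2) - a3 * y 0 (idx 3) = s.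
  by rewrite y2 y3 rho2; field.
have et : a3 * y 0 (idx 2) + a4 * y 0 (idx 3) = t.
  by rewrite y2 y3 rho2; field.
exists y => b; rewrite /sl2_coord; clear y2 y3; clearbody y.
have e4 (a : R) : a * rho * y 0 (idx 4) = a * ((Z false - Z true) / 2).
  by rewrite -mulrA y4.
case: b; apply: mx2P; rewrite !mxE /= ?y0 ?y1 ?e4 ?y5 ?es ?et
  /s /t /X /Y /Z; lra.
Qed.

End Sl2Coordinates.

(** * Comparison of the two groups *)

Lemma prod_mul_continuous (R : realType) (E F : normedModType R)
    (G H : preTopGroupType) (A : set (chart G E)) (B : set (chart H F))
    (q : (G * H) * (G * H)) : lie_group A -> lie_group B ->
  {for q, continuous (fun q : (G * H) * (G * H) => (q.1 * q.2)%g)}.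
Proof.
move=> LG LH.
have c1 : {for q, continuous (fun q : (G * H) * (G * H) => (q.1.1 * q.2.1)%g)}.
  apply: (lie_mul_for LG (f := fun q : (G * H) * (G * H) => q.1.1)).
    by apply: (@continuous_comp _ _ _ fst fst); exact: cvg_fst.
  by apply: (@continuous_comp _ _ _ snd fst); [exact: cvg_snd|exact: cvg_fst].
have c2 : {for q, continuous (fun q : (G * H) * (G * H) => (q.1.2 * q.2.2)%g)}.
  apply: (lie_mul_for LH (f := fun q : (G * H) * (G * H) => q.1.2)).
    by apply: (@continuous_comp _ _ _ fst snd); [exact: cvg_fst|exact: cvg_snd].
  by apply: (@continuous_comp _ _ _ snd snd); exact: cvg_snd.
exact: cvg_pair c1 c2.
Qed.

(** Equal projective coordinates mean proportional matrices, and products of proportional matrices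
    are proportional. *)
Lemma proj_coord_mul (R : realType) (M M' N N' L : 'M[R]_2) (l : R) :
  M 0 0 != 0 -> M' 0 0 != 0 -> N 0 0 != 0 -> N' 0 0 != 0 ->
  proj_coord M = proj_coord N -> proj_coord M' = proj_coord N' ->
  l != 0 -> L = l *: (M * M') -> proj_coord L = proj_coord (N * N').
Proof.
move=> M0 M0' N0 N0' e e' l0 ->.
rewrite (proj_coord_inj M0 N0 e) (proj_coord_inj M0' N0' e').
by rewrite -scalerAl -scalerAr !proj_coordZ // mulf_neq0 // invr_neq0.
Qed.

Theorem proposition5p3 (R : realType) (a3 a4 : R)
    (G : preTopGroupType) (AG : set (chart G 'rV[R]_6))
    (S : preTopGroupType) (AS : set (chart S 'rV[R]_3)) :
  a3 ^+ 2 + a4 ^+ 2 != 0 ->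
  is_G 0 0 a3 a4 AG ->
  is_universal_cover_SL2 AS ->
  locally_isomorphic AG (prod_atlas AS AS).
Proof.
move=> n0 [LG [e1 [e2 [e3 [e4 [e5 [A2 [basis se]]]]]]]] cov.
have sq0 : 0 <= a3 ^+ 2 + a4 ^+ 2 by rewrite addr_ge0 // sqr_ge0.
pose rho := Num.sqrt (a3 ^+ 2 + a4 ^+ 2).
have rho0 : 0 < rho by rewrite sqrtr_gt0 lt_neqAle eq_sym n0.
have rho2 : rho ^+ 2 = a3 ^+ 2 + a4 ^+ 2 by rewrite sqr_sqrtr.
have [_ _ SAG _ _] := LG; have [isG atlG _] := SAG.
have [LS _ _] := cov; have [_ _ [isS _ _] _ _] := LS.
have [c Ac c1] := atlG 1%g.
have cx0 := crng_chart1 LG Ac c1.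
pose e : 6.-tuple (form1 G 'rV[R]_6) := [tuple e1; e2; e3; e4; e5; A2].
(* [v *m B] lists the values of the six forms on the tangent vector [v] at the identity. *)
pose B : 'M[R]_6 := \matrix_(i, j) tnth e j c (c 1%g) (delta_mx 0 i).
have uB : B \in unitmx by exact: coframe_unit LG Ac c1 basis.
have le k : left_invariant AG (tnth e k) by have [H _] := basis; exact: H.
have BE v k : (v *m B) 0 k = tnth e k c (c 1%g) v.
  have [fe _] := le k; rewrite (form_colE Ac v fe cx0) !mxE.
  by apply: eq_bigr => i _; rewrite !mxE.
(* Through the Maurer-Cartan formula the structure equations give the coordinates of the bracket. *)
have BA u v k : (v *m ad c u *m B) 0 k = - ext_d (tnth e k) c (c 1%g) u v.
  by rewrite BE (ext_d_ad LG Ac c1 u v (le k)) opprK.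
pose T b v := sl2_coord a3 a4 rho b (v *m B).
have Tlin b : linear (T b).
  by move=> k u v; rewrite /T mulmxDl -scalemxAl; exact: sl2_coord_linear.
have Tbr b u v : T b (v *m ad c u) = T b u * T b v - T b v * T b u.
  have [s1 s2 s3 s4 [s5 s6]] := se c (c 1%g) u v Ac cx0.
  have tn (k : nat) (w : form1 G 'rV[R]_6) : (k < 6)%N ->
      nth w e k = w -> tnth e (inord k) = w.
    by move=> k6 ew; rewrite (tnth_nth w) inordK.
  have t0 := @tn 0%N e1 isT erefl; have t1 := @tn 1%N e2 isT erefl.
  have t2 := @tn 2%N e3 isT erefl; have t3 := @tn 3%N e4 isT erefl.
  have t4 := @tn 4%N e5 isT erefl; have t5 := @tn 5%N A2 isT erefl.
  apply: (sl2_coord_bracket rho2); rewrite BA !BE ?t0 ?t1 ?t2 ?t3 ?t4 ?t5;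
    rewrite ?s1 ?s2 ?s3 ?s4 ?s5 ?s6 /wedge; ring.
have Ttr b v : \tr (T b v) = 0 by exact: tr_sl2_coord.
have Tinj v : (forall b, T b v = 0) -> v = 0.
  move=> /(sl2_coord_inj rho0 rho2) vB.
  by rewrite -(mulmxK uB v) vB mul0mx.
have Tsurj (M : bool -> 'M[R]_2) : (forall b, \tr (M b) = 0) ->
    exists v, forall b, T b v = M b.
  move=> /(sl2_coord_surj rho0 rho2)[y yM]; exists (y *m invmx B) => b.
  by rewrite /T mulmxKV.
have [hv [ev [fv vP]]] := std_vectors Tsurj.
have [k [ck k1 kE1 kE kM]] := sl2sl2_chart LG Ac c1 Tlin Tbr Ttr Tinj Tsurj vP.
have [p [l [pM cl l1 lE1 lE]]] := universal_cover_chart cov.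
have f6 := @findim_mx R 1 6; have f3 := @findim_mx R 1 3.
apply: (@locally_isomorphic_of_charts R G (S * S)%type _ _ ('rV[R]_3 * 'rV[R]_3)%type
  AG (prod_atlas AS AS) k (prod_chart l l)) => //.
- exact: findim_prod.
- exact: lie_mul_continuous LG (1%g, 1%g).
- exact: (prod_mul_continuous LS LS).
- by move=> _ [d Ad [d' Ad'] <-]; apply: is_chart_prod; exact: isS.
- exact: compatible_chart_prod.
- by rewrite kE1 /= lE1.
- move=> a b x y ka kb kab [lx1 lx2] [ly1 ly2] [lxy1 lxy2].
  have [-> pa] := kE a ka; have [-> pb] := kE b kb; have [-> _] := kE _ kab.
  have [/= lex1 px1] := lE _ lx1; have [/= lex2 px2] := lE _ lx2.
  have [/= ley1 py1] := lE _ ly1; have [/= ley2 py2] := lE _ ly2.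
  have [/= -> _] := lE _ lxy1; have [/= -> _] := lE _ lxy2.
  rewrite lex1 lex2 ley1 ley2 !pM => -[ex1 ex2] [ey1 ey2].
  (* In each factor P(ab) is P(a) P(b) up to a scalar while the covering map is multiplicative, so
     equal projective coordinates of the factors pass to the product. *)
  have [m m0 em] := kM a b false ka kb kab.
  have [m' m0' em'] := kM a b true ka kb kab.
  congr pair.
    exact: (proj_coord_mul (pa _) (pb _) px1 py1 ex1 ey1 m0 em).
  exact: (proj_coord_mul (pa _) (pb _) px2 py2 ex2 ey2 m0' em').
Qed.
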